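(* Let $A$ be a finite dimensional basic algebra over a field $K$ that is $\tau$-tilting finite. Then the bricks in $\mathsf{mod}\,A$ are uniquely determined by their Newton polytopes: if $U$ and $V$ are bricks in $\mathsf{mod}\,A$ with $\mathcal N(U)=\mathcal N(V)$, then $U\cong V$.
   Context: $\mathsf{mod}\,A$ is the category of finitely generated right $A$-modules, $\tau$ is the Auslander-Reiten translation in $\mathsf{mod}\,A$, and $n$ is the number of isomorphism classes of simple $A$-modules. The dimension vector of a module $X\in\mathsf{mod}\,A$ is the vector in $\mathbb Z_{\ge 0}^n$ whose $i$-th entry is the multiplicity of the $i$-th simple module as a composition factor of $X$. Newton polytope: for $U\in\mathsf{mod}\,A$, $\mathcal N(U)\subset\mathbb R^n$ is the convex hull of the dimension vectors of all quotient modules of $U$. A module $S\in\mathsf{mod}\,A$ is a brick if $\operatorname{End}_A(S)$ is a division algebra. For $M\in\mathsf{mod}\,A$, $|M|$ is the number of pairwise non-isomorphic indecomposable direct summands of $M$ (so $|A|=n$). A pair $(M,P)$ with $M\in\mathsf{mod}\,A$ and $P\in\mathsf{mod}\,A$ projective is $\tau$-tilting if $\operatorname{Hom}_A(M,\tau M)=0$, $\operatorname{Hom}_A(P,M)=0$ and $|M|+|P|=|A|$; it is basic if $M$ and $P$ are each direct sums of pairwise non-isomorphic indecomposable modules. The algebra $A$ is $\tau$-tilting finite if there are only finitely many basic $\tau$-tilting pairs in $\mathsf{mod}\,A$ up to isomorphism; equivalently, $\mathsf{mod}\,A$ has only finitely many functorially finite torsion classes, where a torsion class is a full subcategory of $\mathsf{mod}\,A$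 closed under quotients and extensions, and it is functorially finite if it equals, for some $M\in\mathsf{mod}\,A$, the class $\mathsf{Fac}\,M$ of all factor modules of direct summands of finite direct sums of copies of $M$. *)

(* Defs.v *)
From HB Require Import structures.
From mathcomp Require Import all_boot all_order all_algebra all_field.
From mathcomp Require Import boolp classical_sets reals convex.

Set Implicit Arguments.
Unset Strict Implicit.
Unset Printing Implicit Defensive.

Import GRing.Theory.
Local Open Scope ring_scope.

(* Finitely generated modules over a finite dimensional K-algebra are the same
   as finite dimensional ones.  [ract M a] is the map [x |-> x a]; since [x a]
   is K-linear in [a], the K-structure is the one induced by [A]. *)
Record rmod (K : fieldType) (A : falgType K) := RMod {
  rmod_sort :> vectType K;
  ract : {linear A -> 'End(rmod_sort)};
  ract1 : ract 1 = \1%VF;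
  ractM : forall a b : A, ract (a * b) = (ract b \o ract a)%VF }.

Section Modules.
Variables (K : fieldType) (A : falgType K).
Implicit Types M N U V P Q X Y : rmod A.

Lemma regular_ract1 : amulr (1 : A) = \1%VF.
Proof. by apply/lfunP => x; rewrite !lfunE /= mulr1. Qed.

Lemma regular_ractM (a b : A) : amulr (a * b) = (amulr b \o amulr a)%VF.
Proof. by apply/lfunP => x; rewrite !lfunE /= !lfunE /= mulrA. Qed.

(* The module A_A. *)
Definition regular_rmod : rmod A := RMod regular_ract1 regular_ractM.

Definition rmod_hom M N (f : 'Hom(M, N)) : Prop :=
  forall (a : A) (x : M), f (ract M a x) = ract N a (f x).

Definition rmod_iso M N : Prop :=
  exists f : 'Hom(M, N), [/\ rmod_hom f, lker f = 0%VS & limg f = fullv].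

Definition submodule M (W : {vspace M}) : Prop :=
  forall a : A, (ract M a @: W <= W)%VS.

Definition zero_rmod M : Prop := fullv = 0%VS :> {vspace M}.

Definition quotient_of U Q : Prop :=
  exists2 p : 'Hom(U, Q), rmod_hom p & limg p = fullv.

Definition simple_rmod M : Prop :=
  ~ zero_rmod M /\
  forall W : {vspace M}, submodule W -> W = 0%VS \/ W = fullv.

Definition indecomposable M : Prop :=
  ~ zero_rmod M /\
  forall W1 W2 : {vspace M}, submodule W1 -> submodule W2 ->
    (W1 + W2)%VS = fullv -> (W1 :&: W2)%VS = 0%VS -> W1 = 0%VS \/ W2 = 0%VS.

(* End_A(M) is a division algebra; in particular it is not the zero ring. *)
Definition brick M : Prop :=
  ~ zero_rmod M /\
  forall f : 'End(M), rmod_hom f -> f <> 0 ->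
    exists g : 'End(M),
      [/\ rmod_hom g, (g \o f)%VF = \1%VF & (f \o g)%VF = \1%VF].

Definition pairwise_non_iso k (F : 'I_k -> rmod A) : Prop :=
  forall i j, rmod_iso (F i) (F j) -> i = j.

Definition direct_summand N M : Prop :=
  exists (i : 'Hom(N, M)) (p : 'Hom(M, N)),
    [/\ rmod_hom i, rmod_hom p & (p \o i)%VF = \1%VF].

Definition direct_sum_of k (F : 'I_k -> rmod A) M : Prop :=
  exists f : forall i, 'Hom(F i, M),
    [/\ forall i, rmod_hom (f i) /\ lker (f i) = 0%VS,
        directv (\sum_i limg (f i))
      & (\sum_i limg (f i))%VS = fullv].

Definition basic_rmod M : Prop :=
  exists k (F : 'I_k -> rmod A),
    [/\ forall i, indecomposable (F i), pairwise_non_iso F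
      & direct_sum_of F M].

(* |M| = k *)
Definition num_indec_summands M (k : nat) : Prop :=
  exists F : 'I_k -> rmod A,
    [/\ forall i, indecomposable (F i) /\ direct_summand (F i) M,
        pairwise_non_iso F
      & forall N, indecomposable N -> direct_summand N M ->
          exists i, rmod_iso N (F i)].

Definition projective P : Prop :=
  forall X Y (g : 'Hom(X, Y)) (h : 'Hom(P, Y)),
    rmod_hom g -> limg g = fullv -> rmod_hom h ->
    exists2 l : 'Hom(P, X), rmod_hom l & (g \o l)%VF = h.

Section HomSpace.
Variables M N : rmod A.

Definition hom_defect (a : A) (f : 'Hom(M, N)) : 'Hom(M, N) :=
  ((f \o ract M a) - (ract N a \o f))%VF.

Lemma hom_defect_linear a : linear (hom_defect a).
Proof.
move=> c f g.
rewrite /hom_defect comp_lfunDl -comp_lfunZl comp_lfunDr -comp_lfunZr.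
by rewrite scalerBr opprD addrACA.
Qed.

HB.instance Definition _ a :=
  GRing.isSemilinear.Build K 'Hom(M, N) 'Hom(M, N) _ (hom_defect a)
    (GRing.semilinear_linear (hom_defect_linear a)).

(* Hom_A(M, N) as a subspace of Hom_K(M, N), see [mem_homs] below. *)
Definition homs : {vspace 'Hom(M, N)} :=
  (\bigcap_(i < \dim {:A}) lker (linfun (hom_defect (vbasis {:A})`_i)))%VS.

Lemma mem_homs (f : 'Hom(M, N)) : f \in homs <-> rmod_hom f.
Proof.
split=> [/subv_bigcapP fH a x | fH].
  have defect0 (i : 'I_(\dim {:A})) : hom_defect (vbasis {:A})`_i f = 0.
    have := fH i isT; rewrite -memvE memv_ker lfunE /= => /eqP; exact.
  rewrite (coord_vbasis (memvf a)) !linear_sum !sum_lfunE linear_sum.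
  apply: eq_bigr => i _; rewrite !linearZ !lfunE linearZ /=; congr (_ *: _).
  have /lfunP/(_ x)/eqP := defect0 i.
  rewrite add_lfunE opp_lfunE !comp_lfunE zero_lfunE subr_eq0 => /eqP; exact.
apply/subv_bigcapP => i _; rewrite -memvE memv_ker lfunE /=; apply/eqP/lfunP.
move=> x; rewrite add_lfunE opp_lfunE !comp_lfunE zero_lfunE.
by apply/eqP; rewrite fH subr_eq0.
Qed.

End HomSpace.

End Modules.

Arguments regular_rmod {K} A.

(* The Nakayama functor: nu P = D Hom_A(P, A), where D = Hom_K(-, K).  The left
   action of A on Hom_A(P, A) is [(a h) x = a * h x], and the right action on
   the dual is [(phi a) h = phi (a h)]. *)
Section Nakayama.
Variables (K : fieldType) (A : falgType K).

Definition proj_dual (P : rmod A) : vectType K :=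
  subvs_of (homs P (regular_rmod A)).

Section Action.
Variable P : rmod A.

Lemma left_mul_homs (a : A) (h : proj_dual P) :
  (amull a \o vsval h)%VF \in homs P (regular_rmod A).
Proof.
have /mem_homs hH := subvsP h.
by apply/mem_homs => b x; rewrite !comp_lfunE hH /= !lfunE /= mulrA.
Qed.

Definition proj_dual_lact (a : A) : 'End(proj_dual P) :=
  linfun (fun h : proj_dual P =>
    vsproj (homs P (regular_rmod A)) (amull a \o vsval h)%VF).

Lemma proj_dual_lactE a h x :
  vsval (proj_dual_lact a h) x = a * (vsval h : 'Hom(P, A)) x.
Proof.
rewrite /proj_dual_lact; set F := fun h : proj_dual P => _.
have F_lin : linear F.
  by move=> c h1 h2; rewrite /F !linearP /= comp_lfunDr -comp_lfunZr linearP.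
pose mF := GRing.isSemilinear.Build K _ _ _ F (GRing.semilinear_linear F_lin).
pose LF : {linear proj_dual P -> proj_dual P} := HB.pack F mF.
rewrite (lfunE LF) /= /F vsprojK ?left_mul_homs //.
by rewrite comp_lfunE lfunE.
Qed.

Definition nu_ract (a : A) : 'End('Hom(proj_dual P, K^o)) :=
  linfun (fun phi : 'Hom(proj_dual P, K^o) => (phi \o proj_dual_lact a)%VF).

Lemma nu_ractE a phi h : nu_ract a phi h = phi (proj_dual_lact a h).
Proof.
rewrite /nu_ract; set F := fun phi : 'Hom(_, _) => _.
have F_lin : linear F.
  by move=> c f g; rewrite /F comp_lfunDl -comp_lfunZl.
pose mF := GRing.isSemilinear.Build K _ _ _ F (GRing.semilinear_linear F_lin).
pose LF : {linear _ -> _} := HB.pack F mF.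
by rewrite (lfunE LF) /= /F comp_lfunE.
Qed.

Lemma nu_ract_linear : linear nu_ract.
Proof.
move=> c a b; apply/lfunP => phi; apply/lfunP => h.
rewrite add_lfunE scale_lfunE add_lfunE scale_lfunE !nu_ractE -linearP.
congr (phi _); apply/val_inj/lfunP => x.
rewrite /= proj_dual_lactE mulrDl -scalerAl.
by rewrite add_lfunE scale_lfunE !proj_dual_lactE.
Qed.

HB.instance Definition _ :=
  GRing.isSemilinear.Build K A 'End('Hom(proj_dual P, K^o)) _ nu_ract
    (GRing.semilinear_linear nu_ract_linear).

Lemma nu_ract1 : nu_ract 1 = \1%VF.
Proof.
apply/lfunP => phi; apply/lfunP => h; rewrite nu_ractE id_lfunE.
by congr (phi _); apply/val_inj/lfunP => x; rewrite /= proj_dual_lactE mul1r.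
Qed.

Lemma nu_ractM a b : nu_ract (a * b) = (nu_ract b \o nu_ract a)%VF.
Proof.
apply/lfunP => phi; apply/lfunP => h; rewrite comp_lfunE !nu_ractE.
congr (phi _); apply/val_inj/lfunP => x.
by rewrite /= !proj_dual_lactE mulrA.
Qed.

Definition nu : rmod A := RMod nu_ract1 nu_ractM.

End Action.

Definition proj_dual_map (P Q : rmod A) (d : 'Hom(P, Q)) :
    'Hom(proj_dual Q, proj_dual P) :=
  linfun (fun h : proj_dual Q =>
    vsproj (homs P (regular_rmod A)) (vsval h \o d)%VF).

Lemma proj_dual_mapE (P Q : rmod A) (d : 'Hom(P, Q)) h x :
  rmod_hom d -> vsval (proj_dual_map d h) x = vsval h (d x).
Proof.
move=> d_hom; rewrite /proj_dual_map; set F := fun h : proj_dual Q => _.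
have F_lin : linear F.
  by move=> c h1 h2; rewrite /F linearP /= comp_lfunDl -comp_lfunZl linearP.
pose mF := GRing.isSemilinear.Build K _ _ _ F (GRing.semilinear_linear F_lin).
pose LF : {linear proj_dual Q -> proj_dual P} := HB.pack F mF.
rewrite (lfunE LF) /= /F vsprojK ?comp_lfunE //.
have /mem_homs h_hom := subvsP h.
apply/(@mem_homs K A P (regular_rmod A)) => a y.
by rewrite !comp_lfunE d_hom h_hom.
Qed.

Definition nu_map (P Q : rmod A) (d : 'Hom(P, Q)) : 'Hom(nu P, nu Q) :=
  linfun (fun phi : 'Hom(proj_dual P, K^o) => (phi \o proj_dual_map d)%VF).

Lemma nu_mapE (P Q : rmod A) (d : 'Hom(P, Q)) (phi : nu P) :
  nu_map d phi = (phi \o proj_dual_map d)%VF.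
Proof.
rewrite /nu_map; set F := fun phi : 'Hom(_, _) => _.
have F_lin : linear F by move=> c f g; rewrite /F comp_lfunDl -comp_lfunZl.
pose mF := GRing.isSemilinear.Build K _ _ _ F (GRing.semilinear_linear F_lin).
pose LF : {linear 'Hom(proj_dual P, K^o) -> 'Hom(proj_dual Q, K^o)} :=
  HB.pack F mF.
exact: (lfunE LF).
Qed.

Definition superfluous (M : rmod A) (N : {vspace M}) : Prop :=
  forall W : {vspace M}, submodule W -> (W + N)%VS = fullv -> W = fullv.

Definition minimal_projective_presentation (M P1 P0 : rmod A)
    (d : 'Hom(P1, P0)) (e : 'Hom(P0, M)) : Prop :=
  [/\ projective P1 /\ projective P0, rmod_hom d /\ rmod_hom e,
      limg e = fullv, limg d = lker e
    & superfluous (lker e) /\ superfluous (lker d)].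

(* T is isomorphic to tau M = D Tr M.  Since Tr M is the cokernel of
   Hom_A(d, A) : Hom_A(P0, A) -> Hom_A(P1, A) for a minimal projective
   presentation d of M, its dual D Tr M is the kernel of nu P1 -> nu P0. *)
Definition is_tau (M T : rmod A) : Prop :=
  exists (P1 P0 : rmod A) (d : 'Hom(P1, P0)) (e : 'Hom(P0, M)),
    minimal_projective_presentation d e /\
    exists j : 'Hom(T, nu P1),
      [/\ rmod_hom j, lker j = 0%VS & limg j = lker (nu_map d)].

Definition tau_tilting_pair (M P : rmod A) : Prop :=
  [/\ projective P,
      exists2 T, is_tau M T & homs M T = 0%VS,
      homs P M = 0%VS
    & exists m p, [/\ num_indec_summands M m, num_indec_summands P p
                    & num_indec_summands (regular_rmod A) (m + p)]].

End Nakayama.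

Definition tau_tilting_finite (K : fieldType) (A : falgType K) : Prop :=
  exists k (F : 'I_k -> rmod A * rmod A),
    forall M P : rmod A, tau_tilting_pair M P -> basic_rmod M -> basic_rmod P ->
      exists i, rmod_iso M (F i).1 /\ rmod_iso P (F i).2.

Definition basic_algebra (K : fieldType) (A : falgType K) : Prop :=
  basic_rmod (regular_rmod A).

Section Newton.
Variables (K : fieldType) (A : falgType K).

(* S lists the simple modules, once each, up to isomorphism. *)
Definition all_simples n (S : 'I_n -> rmod A) : Prop :=
  [/\ forall i, simple_rmod (S i), pairwise_non_iso S
    & forall X : rmod A, simple_rmod X -> exists i, rmod_iso X (S i)].

(* [composition_factors X s]: X has a composition series with factors s, from
   top to bottom. *)
Inductive composition_factors : rmod A -> seq (rmod A) -> Prop :=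
| CompositionNil (X : rmod A) of zero_rmod X : composition_factors X [::]
| CompositionCons (X Y Q : rmod A) s (i : 'Hom(Y, X)) (p : 'Hom(X, Q)) of
    simple_rmod Q & rmod_hom i & rmod_hom p &
    lker i = 0%VS & limg i = lker p & limg p = fullv &
    composition_factors Y s : composition_factors X (Q :: s).

Definition dimension_vector n (S : 'I_n -> rmod A) (X : rmod A)
    (v : 'rV[nat]_n) : Prop :=
  exists2 s, composition_factors X s &
    forall i, v ord0 i = count (fun Q => `[< rmod_iso Q (S i) >]) s.

Definition convex_hull (R : realType) n (X : set 'rV[R]_n) : set 'rV[R]_n :=
  smallest (@convex_set R 'rV[R]_n) X.

Definition newton_polytope (R : realType) n (S : 'I_n -> rmod A) (U : rmod A) :
    set 'rV[R]_n :=
  convex_hull [set w | exists Q v, [/\ quotient_of U Q, dimension_vector S Q v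
                                     & w = map_mx (GRing.natmul 1) v]]%classic.

End Newton.

Arguments newton_polytope {K A} R {n} S U.

(* Main.v *)
Require Import Defs.
From HB Require Import structures.
From mathcomp Require Import all_boot all_order all_algebra all_field.
From mathcomp Require Import boolp classical_sets reals convex interval_inference.
From mathcomp Require Import ring lra zify.

(* For a tau-rigid module N, the torsion class Gen N of quotients of direct sums of
   copies of N has a support tau-tilting generator, and Gen N consists of the modules
   X with theta(Q) >= 0 for all quotients Q of X, where theta is the sum of the g-vectors
   of the completion of N.  As theta is linear in the dimension vector, this condition
   is read off the Newton polytope.  Starting from Gen A and mutating, tau-tilting
   finiteness yields, for the brick U, a tau-rigid N with U in Gen N such that every
   nonzero B in Gen N receives a nonzero map from U.  If N(U) = N(V), then V lies in
   Gen N.  A nonzero map V -> U is then onto: its image I lies in Gen N, so there is a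
   nonzero endomorphism U -> I -> U, which is invertible.  By symmetry there are
   surjections both ways, so U and V are isomorphic. *)

Set Implicit Arguments.
Unset Strict Implicit.
Unset Printing Implicit Defensive.

Import Order.TTheory GRing.Theory Num.Theory.
Local Open Scope ring_scope.

(** * Modules and homomorphisms *)

(** Three obstacles shape the development. The translation tau is awkward to compute with, so the
    vanishing of Hom(X, tau M) is replaced by the lifting property [extends]: every map P1 -> X
    extends along P1 -> P0. Only [tau_hom0] goes back to tau itself. Secondly, [tau_tilting_finite]
    bounds pairs whose summands number exactly |A|, so a rigid N must be completed and its summands
    counted; the count is linear algebra over the rationals, with a module M read as the function X
    |-> dim Hom(M, X). Thirdly, shrinking Gen N to the modules without maps to some B must leave a
    class with a rigid generator. This is arranged by choosing B such that all nonzero maps from Gen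
    N to B are onto with kernel again in Gen N: then exactly one indecomposable summand of the
    completion maps to B, and dropping it gives the generator. Each such step shrinks Gen N
    strictly, and finiteness stops the process. *)

Section MakeModule.
Variables (K : fieldType) (A : falgType K) (V : vectType K) (act : A -> V -> V).
Hypotheses (act_linear : forall a, linear (act a))
  (act_linearl : forall x, linear (act^~ x))
  (act1 : forall x, act 1 x = x)
  (actM : forall a b x, act (a * b) x = act b (act a x)).

Definition make_ract (a : A) : 'End(V) := linfun (act a).

Lemma make_ractE a x : make_ract a x = act a x.
Proof.
pose m := GRing.isSemilinear.Build K _ _ _ (act a)
  (GRing.semilinear_linear (act_linear a)).
pose L : {linear V -> V} := HB.pack (act a) m.
exact: (lfunE L).
Qed.

Lemma make_ract_linear : linear make_ract.
Proof.
move=> c a b; apply/lfunP => x.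
by rewrite add_lfunE scale_lfunE !make_ractE act_linearl.
Qed.

HB.instance Definition _ :=
  GRing.isSemilinear.Build K A 'End(V) _ make_ract
    (GRing.semilinear_linear make_ract_linear).

Lemma make_ract1 : make_ract 1 = \1%VF.
Proof. by apply/lfunP => x; rewrite make_ractE id_lfunE act1. Qed.

Lemma make_ractM a b : make_ract (a * b) = (make_ract b \o make_ract a)%VF.
Proof. by apply/lfunP => x; rewrite comp_lfunE !make_ractE actM. Qed.

Definition make_rmod : rmod A := @RMod K A V make_ract make_ract1 make_ractM.

End MakeModule.

Section Homs.
Variables (K : fieldType) (A : falgType K).
Implicit Types M N P Q X Y Z : rmod A.

Lemma ractE1 M (x : M) : ract M 1 x = x.
Proof. by rewrite ract1 id_lfunE. Qed.

Lemma ractEM M a b (x : M) : ract M (a * b) x = ract M b (ract M a x).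
Proof. by rewrite ractM comp_lfunE. Qed.

Lemma ract_linearl M (x : M) : linear (fun a => ract M a x).
Proof. by move=> c a b; rewrite linearP add_lfunE scale_lfunE. Qed.

Record rhom M N := RHom { hom_val :> 'Hom(M, N); homP : rmod_hom hom_val }.

Lemma mk_rhom M N (f : M -> N) :
  linear f -> (forall a x, f (ract M a x) = ract N a (f x)) ->
  exists h : rhom M N, forall x, h x = f x.
Proof.
move=> f_lin fA.
pose m := GRing.isSemilinear.Build K _ _ _ f (GRing.semilinear_linear f_lin).
pose L : {linear M -> N} := HB.pack f m.
have fE x : linfun f x = f x by exact: (lfunE L).
have fH : rmod_hom (linfun f) by move=> a x; rewrite !fE fA.
by exists (RHom fH).
Qed.

Lemma hom_ract M N (f : rhom M N) a x : f (ract M a x) = ract N a (f x).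
Proof. exact: homP. Qed.

Lemma hom_id_subproof M : rmod_hom (\1%VF : 'End(M)).
Proof. by move=> a x; rewrite !id_lfunE. Qed.
Definition hid M : rhom M M := RHom (@hom_id_subproof M).
Lemma hidE M x : hid M x = x. Proof. exact: id_lfunE. Qed.

Lemma hom_comp_subproof M N X (g : rhom N X) (f : rhom M N) :
  rmod_hom (hom_val g \o hom_val f)%VF.
Proof. by move=> a x; rewrite !comp_lfunE !hom_ract. Qed.
Definition hcomp M N X (g : rhom N X) (f : rhom M N) : rhom M X :=
  RHom (hom_comp_subproof g f).
Lemma hcompE M N X (g : rhom N X) (f : rhom M N) x : hcomp g f x = g (f x).
Proof. exact: comp_lfunE. Qed.

Lemma hom_zero_subproof M N : rmod_hom (0 : 'Hom(M, N)).
Proof. by move=> a x; rewrite !zero_lfunE linear0. Qed.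
Definition hzero M N : rhom M N := RHom (@hom_zero_subproof M N).
Lemma hzeroE M N x : hzero M N x = 0. Proof. exact: zero_lfunE. Qed.

Lemma hom_add_subproof M N (f g : rhom M N) : rmod_hom (hom_val f + hom_val g).
Proof. by move=> a x; rewrite !add_lfunE !hom_ract linearD. Qed.
Definition hadd M N (f g : rhom M N) : rhom M N := RHom (hom_add_subproof f g).
Lemma haddE M N (f g : rhom M N) x : hadd f g x = f x + g x.
Proof. exact: add_lfunE. Qed.

Lemma hom_scale_subproof M N c (f : rhom M N) : rmod_hom (c *: hom_val f).
Proof. by move=> a x; rewrite !scale_lfunE !hom_ract linearZ. Qed.
Definition hscale M N c (f : rhom M N) : rhom M N := RHom (hom_scale_subproof c f).
Lemma hscaleE M N c (f : rhom M N) x : hscale c f x = c *: f x.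
Proof. exact: scale_lfunE. Qed.

Definition hopp M N (f : rhom M N) : rhom M N := hscale (-1) f.
Lemma hoppE M N (f : rhom M N) x : hopp f x = - f x.
Proof. by rewrite hscaleE scaleN1r. Qed.

Lemma hom_sum_subproof M N (I : finType) (f : I -> rhom M N) :
  rmod_hom (\sum_i hom_val (f i)).
Proof.
by move=> a x; rewrite !sum_lfunE linear_sum; apply: eq_bigr => i _; rewrite hom_ract.
Qed.
Definition hsum M N (I : finType) (f : I -> rhom M N) : rhom M N :=
  RHom (hom_sum_subproof f).
Lemma hsumE M N (I : finType) (f : I -> rhom M N) x : hsum f x = \sum_i f i x.
Proof. exact: sum_lfunE. Qed.

Definition homE := (hidE, hcompE, hzeroE, haddE, hscaleE, hoppE, hsumE).

Definition inj M N (f : rhom M N) := forall x, f x = 0 -> x = 0.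
Definition surj M N (f : rhom M N) := forall y, exists x, f x = y.

Lemma injP M N (f : rhom M N) : inj f -> injective f.
Proof.
move=> fI x y e; apply/eqP; rewrite -subr_eq0; apply/eqP/fI.
by rewrite linearB /= e subrr.
Qed.

Lemma inj_lker M N (f : rhom M N) : inj f <-> lker f = 0%VS.
Proof.
split=> [fI | k0 x fx].
  by apply/eqP/lker0P; exact: injP.
have: x \in lker f by rewrite memv_ker fx.
by rewrite k0 memv0 => /eqP.
Qed.

Lemma surj_limg M N (f : rhom M N) : surj f <-> limg f = fullv.
Proof.
split=> [fS | ff y].
  apply/eqP; rewrite eqEsubv subvf; apply/subvP => y _.
  by have [x <-] := fS y; apply/memv_img/memvf.
have /memv_imgP[x _ ->]: y \in limg f by rewrite ff memvf.
by exists x.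
Qed.

Definition dimM M := \dim {:M}.

Lemma inj_dim M N (f : rhom M N) : inj f -> (dimM M <= dimM N)%N.
Proof.
move=> /inj_lker fI; rewrite /dimM -(@limg_dim_eq _ _ _ f fullv).
  exact/dimvS/subvf.
by rewrite fI capv0.
Qed.

Lemma surj_dim M N (f : rhom M N) : surj f -> (dimM N <= dimM M)%N.
Proof.
move=> /surj_limg fS; rewrite /dimM -fS -[X in (_ <= X)%N](limg_ker_dim f).
exact: leq_addl.
Qed.

Lemma inj_surj M N (f : rhom M N) : inj f -> (dimM N <= dimM M)%N -> surj f.
Proof.
move=> /inj_lker fI d; apply/surj_limg/eqP; rewrite eqEdim subvf /=.
by rewrite (@limg_dim_eq _ _ _ f fullv) // fI capv0.
Qed.

Lemma surj_inj M N (f : rhom M N) : surj f -> (dimM M <= dimM N)%N -> inj f.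
Proof.
move=> /surj_limg fS d; apply/inj_lker/eqP; rewrite -dimv_eq0 -[lker f]capfv.
have := limg_ker_dim f fullv; rewrite fS.
move: d; rewrite /dimM => d e; rewrite -leqn0.
by move: d; rewrite -e -{2}[\dim {:N}]add0n leq_add2r.
Qed.

Definition iso M N := exists f : rhom M N, inj f /\ surj f.

Lemma isoP M N : iso M N <-> rmod_iso M N.
Proof.
split=> [[f [/inj_lker fI /surj_limg fS]] | [f [fH fI fS]]].
  by exists f; split=> //; exact: homP.
by exists (RHom fH); split; [apply/inj_lker | apply/surj_limg].
Qed.

Lemma factor_surj M Q X (p : rhom M Q) (f : rhom M X) :
  surj p -> (forall x, p x = 0 -> f x = 0) ->
  exists g : rhom Q X, forall x, g (p x) = f x.
Proof.
move=> pS pf.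
have pV y : p ((hom_val p)^-1%VF y) = y.
  by apply: limg_lfunVK; rewrite (surj_limg p).1 // memvf.
have gE x : (hom_val f \o (hom_val p)^-1)%VF (p x) = f x.
  rewrite comp_lfunE; apply/eqP; rewrite -subr_eq0 -linearB /=; apply/eqP/pf.
  by rewrite linearB /= pV subrr.
suff gH : rmod_hom (hom_val f \o (hom_val p)^-1)%VF by exists (RHom gH).
by move=> a y; have [x <-] := pS y; rewrite -hom_ract !gE hom_ract.
Qed.

Lemma factor_inj N M X (i : rhom N M) (f : rhom X M) :
  inj i -> (forall x, exists y, f x = i y) ->
  exists g : rhom X N, forall x, i (g x) = f x.
Proof.
move=> iI fi.
have gE x : i (((hom_val i)^-1 \o hom_val f)%VF x) = f x.
  rewrite comp_lfunE; have [y ->] := fi x.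
  by rewrite limg_lfunVK // memv_img // memvf.
suff gH : rmod_hom ((hom_val i)^-1 \o hom_val f)%VF by exists (RHom gH).
by move=> a y; apply: (injP iI); rewrite hom_ract !gE hom_ract.
Qed.

Lemma submodule_exists M (W : {vspace M}) : submodule W ->
  exists N (i : rhom N M), inj i /\ forall x, x \in W <-> exists y, i y = x.
Proof.
move=> WA.
have WaP a x : x \in W -> ract M a x \in W.
  by move=> xW; apply: (subvP (WA a)); apply: memv_img.
pose act (a : A) (x : subvs_of W) : subvs_of W :=
  vsproj W (ract M a (vsval x)).
have actE a x : vsval (act a x) = ract M a (vsval x).
  by rewrite vsprojK ?WaP ?subvsP.
have act_linear a : linear (act a).
  by move=> c x y; apply: val_inj; rewrite /= !actE -linearP.
have act_linearl x : linear (act^~ x).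
  by move=> c a b; apply: val_inj; rewrite /= !actE ract_linearl.
have act1 x : act 1 x = x by apply: val_inj; rewrite /= actE ractE1.
have actM a b x : act (a * b) x = act b (act a x).
  by apply: val_inj; rewrite /= !actE ractEM.
pose N := make_rmod act_linear act_linearl act1 actM.
have [||i iE] := @mk_rhom N M (fun x => vsval (x : subvs_of W)).
- by move=> c x y; rewrite linearP.
- by move=> a x; rewrite /= make_ractE.
exists N, i; split=> [x | x].
  by rewrite iE => e; apply: val_inj; rewrite /= e.
split=> [xW | [y <-]]; last by rewrite iE subvsP.
by exists (Subvs xW); rewrite iE.
Qed.

Lemma quotient_exists M (W : {vspace M}) : submodule W ->
  exists Q (p : rhom M Q), surj p /\ forall x, p x = 0 <-> x \in W.
Proof.
(* The quotient is realised on the complement [W^C], with [pr] the projection along [W]. An element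
   acts on a representative and the result is projected back; stability of [W] makes this compatible
   with [pr]. *)
move=> WA; pose V := subvs_of (W^C)%VS; pose pr (x : M) : V := vsproj _ (x - projv W x).
have prE x : vsval (pr x) = x - projv W x by rewrite vsprojK ?memv_projC.
have pr_lin : linear pr.
  move=> c x y; apply: val_inj; rewrite /= !prE linearP /=.
  by rewrite scalerBr opprD addrACA.
have pr0 x : pr x = 0 <-> x \in W.
  split=> [/(congr1 vsval)|xW]; last by apply: val_inj; rewrite /= prE projv_id // subrr.
  by rewrite prE linear0 => /eqP; rewrite subr_eq0 => /eqP->; exact: memv_proj.
have prW x y : x - y \in W -> pr x = pr y.
  move=> /pr0; pose m := GRing.isSemilinear.Build K _ _ _ pr
    (GRing.semilinear_linear pr_lin).
  pose L : {linear M -> V} := HB.pack pr m; rewrite -[pr _]/(L _) linearB /=.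
  by move/eqP; rewrite subr_eq0 => /eqP.
have prV (x : V) : pr (vsval x) = x.
  apply: val_inj; rewrite /= prE; set w := vsval x.
  suff -> : projv W w = 0 by rewrite subr0.
  apply/eqP; rewrite -memv_ker lker_proj; exact: subvsP.
have WaP a x : x \in W -> ract M a x \in W.
  by move=> xW; apply: (subvP (WA a)); apply: memv_img.
pose act (a : A) (x : V) : V := pr (ract M a (vsval x)).
have actE a x : act a (pr x) = pr (ract M a x).
  apply: prW; rewrite -linearB /= WaP // prE.
  by rewrite addrAC subrr sub0r memvN memv_proj.
have act_linear a : linear (act a).
  by move=> c x y; rewrite /act -pr_lin !linearP.
have act_linearl x : linear (act^~ x).
  by move=> c a b; rewrite /act -pr_lin ract_linearl.
have act1 x : act 1 x = x by rewrite /act ractE1 prV.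
have actM a b x : act (a * b) x = act b (act a x).
  by rewrite -(prV x) !actE ractEM.
pose Q := make_rmod act_linear act_linearl act1 actM.
have [||p pE] := @mk_rhom M Q pr.
- exact: pr_lin.
- move=> a x; exact (etrans (esym (actE a x)) (esym (make_ractE act_linear a (pr x)))).
exists Q, p; split=> [x | x]; last by rewrite pE.
by exists (vsval (x : V)); rewrite pE prV.
Qed.

Lemma submodule_lker M N (f : rhom M N) : submodule (lker f).
Proof.
move=> a; apply/subvP => _ /memv_imgP[x xk ->].
by move: xk; rewrite !memv_ker hom_ract => /eqP->; rewrite linear0.
Qed.

Lemma submodule_limg M N (f : rhom M N) : submodule (limg f).
Proof.
move=> a; apply/subvP => _ /memv_imgP[_ /memv_imgP[x _ ->] ->].
by rewrite -hom_ract memv_img // memvf.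
Qed.

Lemma mem_limg M N (f : rhom M N) y : y \in limg f <-> exists x, f x = y.
Proof.
split=> [/memv_imgP[x _ ->] | [x <-]]; first by exists x.
by rewrite memv_img // memvf.
Qed.

Lemma ker_exists M N (f : rhom M N) :
  exists X (i : rhom X M), inj i /\ forall x, f x = 0 <-> exists y, i y = x.
Proof.
have [X [i [iI iE]]] := submodule_exists (submodule_lker f).
exists X, i; split=> // x; rewrite -iE memv_ker.
by split=> /eqP.
Qed.

Lemma coker_exists M N (f : rhom M N) :
  exists X (p : rhom N X), surj p /\ forall x, p x = 0 <-> exists y, f y = x.
Proof.
have [X [p [pS pE]]] := quotient_exists (submodule_limg f).
by exists X, p; split=> // x; rewrite pE mem_limg.
Qed.

Lemma im_factor M N (f : rhom M N) :
  exists X (p : rhom M X) (i : rhom X N), [/\ surj p, inj i & forall x, f x = i (p x)].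
Proof.
have [X [i [iI iE]]] := submodule_exists (submodule_limg f).
have [|p pE] := factor_inj (f := f) iI.
  by move=> x; have [|y <-] := (iE (f x)).1; [apply/mem_limg; exists x | exists y].
exists X, p, i; split=> // y.
have /mem_limg[x e]: i y \in limg f by apply/iE; exists y.
by exists x; apply: (injP iI); rewrite pE.
Qed.

Lemma inv_exists M N (f : rhom M N) : inj f -> surj f ->
  exists g : rhom N M, (forall x, g (f x) = x) /\ (forall y, f (g y) = y).
Proof.
move=> fI fS; have [|g gE] := factor_surj (f := hid M) fS.
  by move=> x /fI->; rewrite hidE.
have gK x : g (f x) = x by rewrite gE hidE.
by exists g; split=> // y; have [x <-] := fS y; rewrite gK.
Qed.

Lemma iso_refl M : iso M M.
Proof. by exists (hid M); split=> x; rewrite ?hidE //; exists x; rewrite hidE. Qed.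

Lemma iso_sym M N : iso M N -> iso N M.
Proof.
move=> [f [fI fS]]; have [g [gf fg]] := inv_exists fI fS.
exists g; split=> [y gy | x]; last by exists (f x).
by rewrite -(fg y) gy linear0.
Qed.

Lemma iso_trans M N X : iso M N -> iso N X -> iso M X.
Proof.
move=> [f [fI fS]] [g [gI gS]]; exists (hcomp g f); split=> [x | y].
  by rewrite hcompE => /gI/fI.
by have [z <-] := gS y; have [x <-] := fS z; exists x; rewrite hcompE.
Qed.

Lemma zero_rmodP M : zero_rmod M <-> forall x : M, x = 0.
Proof.
split=> [z x | z].
  by have := memvf x; rewrite z memv0 => /eqP.
apply/eqP; rewrite -subv0; apply/subvP => x _.
by rewrite (z x) mem0v.
Qed.

Lemma nonzero_rmodP M : ~ zero_rmod M <-> exists x : M, x <> 0.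
Proof.
rewrite zero_rmodP; split=> [|[x xn0] z]; last exact: xn0 (z x).
by move=> /existsNP.
Qed.

Lemma zero_dim M : zero_rmod M <-> dimM M = 0%N.
Proof.
by rewrite /zero_rmod /dimM; split=> [-> | /eqP]; rewrite ?dimv0 // dimv_eq0 => /eqP.
Qed.

Lemma zero_exists : exists Z : rmod A, zero_rmod Z.
Proof.
have [Z [i [iI _]]] := ker_exists (hid (regular_rmod A)).
have [Q [p [pS pE]]] := coker_exists (hid (regular_rmod A)).
exists Q; apply/zero_rmodP => y; have [x <-] := pS y.
by apply/pE; exists x; rewrite hidE.
Qed.

Lemma sum2_exists M N : exists S (i1 : rhom M S) (i2 : rhom N S)
    (p1 : rhom S M) (p2 : rhom S N),
  [/\ forall x, p1 (i1 x) = x, forall x, p2 (i2 x) = x,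
      forall x, p2 (i1 x) = 0, forall x, p1 (i2 x) = 0 &
      forall s, i1 (p1 s) + i2 (p2 s) = s].
Proof.
pose V : vectType K := (M * N)%type.
pose act (a : A) (x : V) : V := (ract M a x.1, ract N a x.2).
have act_linear a : linear (act a).
  by move=> c [x1 x2] [y1 y2]; rewrite /act /= !linearP.
have act_linearl x : linear (act^~ x).
  by move=> c a b; rewrite /act !ract_linearl.
have act1 x : act 1 x = x by rewrite /act !ractE1; case: x.
have actM a b x : act (a * b) x = act b (act a x).
  by rewrite /act !ractEM.
pose S := make_rmod act_linear act_linearl act1 actM.
have [||i1 i1E] := @mk_rhom M S (fun x => (x, 0) : V).
- by move=> c x y; congr pair; rewrite /= scaler0 addr0.
- by move=> a x; rewrite [RHS](make_ractE act_linear a) /act linear0.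
have [||i2 i2E] := @mk_rhom N S (fun x => (0, x) : V).
- by move=> c x y; congr pair; rewrite /= scaler0 addr0.
- by move=> a x; rewrite [RHS](make_ractE act_linear a) /act linear0.
have [||p1 p1E] := @mk_rhom S M (fun x => (x : V).1).
- by [].
- by move=> a x; rewrite [X in X.1](make_ractE act_linear a).
have [||p2 p2E] := @mk_rhom S N (fun x => (x : V).2).
- by [].
- by move=> a x; rewrite [X in X.2](make_ractE act_linear a).
exists S, i1, i2, p1, p2; split=> x; rewrite ?p1E ?p2E ?i1E ?i2E //=.
case: x => x y.
by congr pair; rewrite /= ?addr0 ?add0r.
Qed.

End Homs.

Arguments hid {K A} M.
Arguments hzero {K A} M N.

(** * Direct sum decompositions *)

Section Decomposition.
Variables (K : fieldType) (A : falgType K).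
Implicit Types M N P Q X Y Z : rmod A.

Definition sum2 M N S (i1 : rhom M S) (i2 : rhom N S) (p1 : rhom S M) (p2 : rhom S N) :=
  [/\ forall x, p1 (i1 x) = x, forall x, p2 (i2 x) = x,
      forall x, p2 (i1 x) = 0, forall x, p1 (i2 x) = 0 &
      forall s, i1 (p1 s) + i2 (p2 s) = s].

Definition is_sum2 M N S := exists i1 i2 p1 p2, @sum2 M N S i1 i2 p1 p2.

Definition biprod k (F : 'I_k -> rmod A) M (i : forall j, rhom (F j) M)
    (p : forall j, rhom M (F j)) :=
  [/\ forall j x, p j (i j x) = x, forall j l x, j != l -> p l (i j x) = 0 &
      forall x, \sum_j i j (p j x) = x].

Definition dsum k (F : 'I_k -> rmod A) M := exists i p, @biprod k F M i p.

(** The family is dependent, so head and tail are glued by transport along [i = lift ord0 j];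
    uniqueness of equality proofs on ordinals makes that transport trivial. *)
Lemma ord_fun_exists k (T : 'I_k.+1 -> Type) (x0 : T ord0)
    (f : forall j, T (lift ord0 j)) :
  exists g : forall i, T i, g ord0 = x0 /\ forall j, g (lift ord0 j) = f j.
Proof.
have H (i : 'I_k.+1) : {j | i = lift ord0 j} + {i = ord0}.
  by case: (unliftP ord0 i) => [j|] ->; [left; exists j | right].
pose g i : T i := match H i with
  | inleft (exist j e) => eq_rect_r T (f j) e
  | inright e => eq_rect_r T x0 e end.
exists g; split=> [|j]; rewrite /g.
  case: (H ord0) => [[j e]|e]; last by rewrite eq_axiomK.
  by have := congr1 val e.
case: (H _) => [[l e]|e]; last by have := congr1 val e.
have ejl := lift_inj e; subst l.
by rewrite eq_axiomK.
Qed.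

Lemma dsum_cons k (F : 'I_k.+1 -> rmod A) M N :
  dsum (fun j => F (lift ord0 j)) N -> is_sum2 (F ord0) N M -> dsum F M.
Proof.
move=> [i [p [pi pi0 ip]]] [i1 [i2 [p1 [p2 [e11 e22 e12 e21 es]]]]].
have [I [I0 IS]] := @ord_fun_exists k (fun j => rhom (F j) M) i1
  (fun j => hcomp i2 (i j)).
have [J [J0 JS]] := @ord_fun_exists k (fun j => rhom M (F j)) p1
  (fun j => hcomp (p j) p2).
exists I, J; split=> [j x|j l x|x].
- case: (unliftP ord0 j) => [j'|] e; subst j.
    by rewrite IS JS !homE e22 pi.
  by rewrite I0 J0 e11.
- case: (unliftP ord0 j) => [j'|] e; subst j; case: (unliftP ord0 l) => [l'|] e' jl;
    subst l; rewrite ?IS ?JS ?I0 ?J0 ?homE ?e22 ?e12 ?e21 ?linear0 //.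
  by rewrite pi0 //; apply: contraNneq jl => ->.
- rewrite big_ord_recl I0 J0; rewrite -[RHS]es; congr (_ + _).
  rewrite -[in RHS](ip (p2 x)) linear_sum; apply: eq_bigr => j _.
  by rewrite IS JS !homE.
Qed.

Lemma dsum_exists k (F : 'I_k -> rmod A) : exists M, dsum F M.
Proof.
elim: k F => [|k IH] F.
  have [Z /zero_rmodP Z0] := zero_exists A.
  exists Z, (fun j => hzero (F j) Z), (fun j => hzero Z (F j)).
  by split=> [[]|[]|x] //; rewrite big_ord0 [RHS]Z0.
have [N Nd] := IH (fun j => F (lift ord0 j)).
have [M [i1 [i2 [p1 [p2 H]]]]] := sum2_exists (F ord0) N.
by exists M; apply: dsum_cons Nd _; exists i1, i2, p1, p2.
Qed.

Definition retract X M (i : rhom X M) (p : rhom M X) := forall x, p (i x) = x.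

Lemma retract_sum2 X M (i : rhom X M) (p : rhom M X) : retract i p ->
  exists N i2 p2, @sum2 X N M i i2 p p2.
Proof.
move=> pi; have [N [i2 [i2I i2E]]] := ker_exists p.
have [|p2 p2E] := factor_inj (f := hadd (hid M) (hopp (hcomp i p))) i2I.
  move=> x; suff /i2E[y <-]: p (hadd (hid M) (hopp (hcomp i p)) x) = 0 by exists y.
  by rewrite !homE linearB /= pi subrr.
have pi2 x : p (i2 x) = 0 by apply/i2E; exists x.
exists N, i2, p2; split=> // x; first 2 last.
- by rewrite p2E !homE addrCA subrr addr0.
- by apply: (injP i2I); rewrite p2E !homE pi2 linear0 subr0.
by apply: (injP i2I); rewrite p2E !homE pi subrr linear0.
Qed.

Lemma indec_of_sum2 M : ~ zero_rmod M ->
  (forall X N, is_sum2 X N M -> zero_rmod X \/ zero_rmod N) -> indecomposable M.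
Proof.
move=> M0 H; split=> // W1 W2 W1s W2s W12 W120.
have [X [i [iI iE]]] := submodule_exists W1s.
have [Y [j [jI jE]]] := submodule_exists W2s.
have [S [i1 [i2 [p1 [p2 [e11 e22 e12 e21 es]]]]]] := sum2_exists X Y.
pose f := hadd (hcomp i p1) (hcomp j p2).
have fE s : f s = i (p1 s) + j (p2 s) by rewrite !homE.
have iW x : i x \in W1 by apply/iE; exists x.
have jW x : j x \in W2 by apply/jE; exists x.
have fI : inj f.
  move=> s; rewrite fE => /eqP; rewrite addr_eq0 => /eqP e.
  have : i (p1 s) \in (W1 :&: W2)%VS by rewrite memv_cap iW e memvN jW.
  rewrite W120 memv0 => /eqP z; have z1 := iI _ z.
  move: e; rewrite z => /esym /eqP; rewrite oppr_eq0 => /eqP /jI z2.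
  by rewrite -(es s) z1 z2 !linear0 addr0.
have fS : surj f.
  move=> x; have : x \in (W1 + W2)%VS by rewrite W12 memvf.
  case/memv_addP=> _ /iE[y <-] [_ /jE[z <-] ->].
  by exists (i1 y + i2 z); rewrite fE !linearD /= e11 e22 e12 e21 !linear0 addr0 add0r.
have [g [gf fg]] := inv_exists fI fS.
have fi1 x : f (i1 x) = i x by rewrite fE e11 e12 linear0 addr0.
have fi2 x : f (i2 x) = j x by rewrite fE e22 e21 linear0 add0r.
have [] := H X Y.
- exists i, j, (hcomp p1 g), (hcomp p2 g).
  split=> x; rewrite ?homE.
  + by rewrite -fi1 gf.
  + by rewrite -fi2 gf.
  + by rewrite -fi1 gf.
  + by rewrite -fi2 gf.
  + by rewrite -fE fg.
- move=> /zero_rmodP z; left; apply/eqP; rewrite -subv0; apply/subvP => x.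
  by case/iE=> y <-; rewrite (z y) linear0 mem0v.
- move=> /zero_rmodP z; right; apply/eqP; rewrite -subv0; apply/subvP => x.
  by case/jE=> y <-; rewrite (z y) linear0 mem0v.
Qed.

Lemma sum2_dim X N M : is_sum2 X N M -> dimM M = (dimM X + dimM N)%N.
Proof.
move=> [i1 [i2 [p1 [p2 [e11 e22 e12 e21 es]]]]].
have i1I : inj i1 by move=> x e; rewrite -(e11 x) e linear0.
have p1S : surj p1 by move=> x; exists (i1 x).
rewrite /dimM -(limg_ker_dim p1 fullv) capfv (surj_limg p1).1 // addnC; congr (_ + _)%N.
have -> : lker p1 = limg i2.
  apply/vspaceP => x; apply/idP/idP.
    rewrite memv_ker => /eqP e; apply/mem_limg; exists (p2 x).
    by rewrite -[RHS]es e linear0 add0r.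
  by case/mem_limg=> y <-; rewrite memv_ker e21.
rewrite limg_dim_eq // (inj_lker i2).1 ?capv0 //.
by move=> x e; rewrite -(e22 x) e linear0.
Qed.

Lemma sum2A X X' Y N M : is_sum2 N Y M -> is_sum2 X X' N -> exists Z, is_sum2 X Z M.
Proof.
move=> [i1 [i2 [p1 [p2 [e11 e22 e12 e21 es]]]]].
move=> [j1 [j2 [q1 [q2 [f11 f22 f12 f21 fs]]]]].
have [|Z [k [r H]]] := @retract_sum2 X M (hcomp i1 j1) (hcomp q1 p1).
  by move=> x; rewrite !homE e11 f11.
by exists Z, (hcomp i1 j1), k, (hcomp q1 p1), r.
Qed.

Lemma indec_summand M : ~ zero_rmod M ->
  exists X N, indecomposable X /\ is_sum2 X N M.
Proof.
move=> M0; have [n] := ubnP (dimM M).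
elim: n M M0 => // n IH M M0 /ltnSE Mn.
have [M_indec|M_dec] := pselect (indecomposable M).
  have [|N [i2 [p2 H]]] := @retract_sum2 M M (hid M) (hid M).
    by move=> x; rewrite !homE.
  by exists M, N; split=> //; exists (hid M), i2, (hid M), p2.
have /existsNP[X /existsNP[Y /not_implyP[S /not_orP[X0 Y0]]]]:
    ~ forall X Y, is_sum2 X Y M -> zero_rmod X \/ zero_rmod Y.
  by move=> H; apply/M_dec/indec_of_sum2.
have [|X' [N [X'i H]]] := IH X X0.
  rewrite (leq_trans _ Mn) // (sum2_dim S) -{1}[dimM X]addn0 ltn_add2l lt0n.
  by apply/eqP => /zero_dim.
have [N' H'] := sum2A S H.
by exists X', N'.
Qed.

Lemma ord_cons_exists k T (x0 : T) (f : 'I_k -> T) :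
  exists g : 'I_k.+1 -> T, g ord0 = x0 /\ f = fun j => g (lift ord0 j).
Proof.
have [g [g0 gS]] := @ord_fun_exists k (fun _ => T) x0 f.
by exists g; split=> //; apply/funext => j; rewrite gS.
Qed.

Lemma decomposition_exists M :
  exists k (F : 'I_k -> rmod A), (forall j, indecomposable (F j)) /\ dsum F M.
Proof.
have [n] := ubnP (dimM M).
elim: n M => // n IH M /ltnSE Mn.
have [/zero_rmodP M0|M0] := pselect (zero_rmod M).
  exists 0%N, (fun _ => M); split; first by case.
  exists (fun j => hid M), (fun j => hid M).
  by split=> [[]|[]|x] //; rewrite big_ord0 [RHS]M0.
have [X [N [Xi H]]] := indec_summand M0.
have [|k [F [Fi Fd]]] := IH N.
  rewrite (leq_trans _ Mn) // (sum2_dim H) -{1}[dimM N]add0n ltn_add2r lt0n.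
  by apply/eqP => /zero_dim; case: Xi.
have [G [G0 GS]] := ord_cons_exists X F; subst X F.
exists k.+1, G; split; last exact: dsum_cons Fd H.
by move=> j; case: (unliftP ord0 j) => [l|] ->.
Qed.

(** * Fitting's lemma, local endomorphism rings and the Krull-Schmidt theorem *)

Fixpoint hiter n M (f : rhom M M) : rhom M M :=
  if n is n'.+1 then hcomp f (hiter n' f) else hid M.

Lemma hiterE n M (f : rhom M M) x : hiter n f x = iter n f x.
Proof. by elim: n => [|n IH] /=; rewrite !homE // IH. Qed.

(** A power of [f] whose image has least dimension maps its image onto itself, so image and kernel
    meet in zero. The exponent is a successor so that the kernel of [f] lies in the kernel of the
    power, which [indec_endo] needs. *)
Lemma fitting M (f : rhom M M) : exists n,
  (limg (hiter n.+1 f) :&: lker (hiter n.+1 f))%VS = 0%VS /\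
  (limg (hiter n.+1 f) + lker (hiter n.+1 f))%VS = fullv.
Proof.
pose P d := `[< exists n, d = \dim (limg (hiter n.+1 f)) >].
have exP : exists d, P d by exists (\dim (limg (hiter 1 f))); apply/asboolP; exists 0%N.
case: (ex_minnP exP) => _ /asboolP[n ->] dmin; exists n.
set h := hiter n.+1 f.
have hh : (h @: limg h = limg h)%VS.
  have hhE : (h @: limg h)%VS = limg (hiter (n.+1 + n).+1 f).
    apply/vspaceP => y; apply/idP/idP.
      case/memv_imgP=> _ /memv_imgP[x _ ->] ->; apply/mem_limg.
      by exists x; rewrite !hiterE -iterD addnS.
    case/mem_limg=> x <-; rewrite hiterE -addnS iterD -!hiterE.
    by rewrite !memv_img ?memvf.
  apply/eqP; rewrite eqEdim limgS ?subvf //= hhE.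
  by apply: dmin; apply/asboolP; exists (n.+1 + n)%N.
have c0 : (limg h :&: lker h)%VS = 0%VS.
  apply/eqP; rewrite -dimv_eq0; have := limg_ker_dim h (limg h); rewrite hh.
  by move/eqP; rewrite -{2}[\dim (limg h)]add0n eqn_add2r.
split=> //; apply/eqP; rewrite eqEdim subvf /= dimv_disjoint_sum //.
by rewrite -(limg_ker_dim h fullv) capfv addnC.
Qed.

Definition nilp M (f : rhom M M) := exists n, forall x, iter n f x = 0.

Lemma indec_endo M (f : rhom M M) : indecomposable M -> nilp f \/ inj f.
Proof.
move=> [M0 Mi]; have [n [h0 h1]] := fitting f.
have [||||/eqP l0|k0] := Mi (limg (hiter n.+1 f)) (lker (hiter n.+1 f)) => //.
- exact: submodule_limg.
- exact: submodule_lker.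
- left; exists n.+1 => x; apply/eqP; rewrite -memv0 -(eqP l0) -hiterE.
  by rewrite memv_img ?memvf.
- by right=> x fx; apply: ((inj_lker _).2 k0); rewrite hiterE iterSr fx -hiterE linear0.
Qed.

Lemma inj_endo_surj M (f : rhom M M) : inj f -> surj f.
Proof. by move=> fI; apply: inj_surj. Qed.

(* If [f + g] has inverse [u], then [u f + u g = 1], and [1] minus a nilpotent map
   is injective. *)
Lemma noninj_add M (f g : rhom M M) : indecomposable M -> ~ inj f -> ~ inj g ->
  ~ inj (hadd f g).
Proof.
move=> Mi fI gI sI; have [u [us su]] := inv_exists sI (inj_endo_surj sI).
have uI : inj u by move=> y uy; rewrite -(su y) uy linear0.
have ufg x : u (f x) + u (g x) = x by rewrite -linearD -[RHS]us homE.
have [[n ufn]|ufI] := indec_endo (hcomp u f) Mi; last first.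
  by apply: fI => x fx; apply: ufI; rewrite homE fx linear0.
apply: gI => x gx.
have e : hcomp u f x = x by rewrite homE -[RHS]ufg gx linear0 addr0.
by rewrite -(ufn x); elim: n {ufn} => //= n <-.
Qed.

Lemma noninj_sum M (I : finType) (f : I -> rhom M M) : indecomposable M ->
  inj (hsum f) -> exists i, inj (f i).
Proof.
move=> Mi sI; apply: contrapT => /forallNP fI.
pose P (phi : 'End(M)) := exists2 h : rhom M M, hom_val h = phi & ~ inj h.
have [h hE hI] : P (\sum_i hom_val (f i)).
  apply: (big_ind P) => [|_ _ [h1 <- I1] [h2 <- I2]|i _].
  - exists (hzero M M) => // zI; case: Mi => /nonzero_rmodP[x xn0] _.
    by apply/xn0/zI; rewrite homE.
  - by exists (hadd h1 h2) => //; exact: noninj_add.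
  - by exists (f i).
by apply: hI => x hx; apply: sI; rewrite /= -hE.
Qed.

(** An injective endomorphism in finite dimension is invertible, and its inverse corrects [v] to a
    retraction of [u]. *)
Lemma retract_of_inj X M (u : rhom X M) (v : rhom M X) : inj (hcomp v u) ->
  exists w, retract u (hcomp w v).
Proof.
move=> vuI; have [w [wE _]] := inv_exists vuI (inj_endo_surj vuI).
by exists w => x; rewrite !homE -{2}[x]wE homE.
Qed.

Lemma indec_retract_iso X M (i : rhom X M) (p : rhom M X) :
  retract i p -> ~ zero_rmod X -> indecomposable M -> iso X M.
Proof.
move=> pi X0 [M0 Mi].
have iI : inj i by move=> x e; rewrite -(pi x) e linear0.
have [||||/eqP l0|k0] := Mi (limg i) (lker p) => //.
- exact: submodule_limg.
- exact: submodule_lker.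
- apply/eqP; rewrite eqEsubv subvf; apply/subvP => x _.
  have -> : x = i (p x) + (x - i (p x)) by rewrite addrCA subrr addr0.
  by rewrite memv_add ?memv_img ?memvf // memv_ker linearB /= pi subrr.
- apply/eqP; rewrite -subv0; apply/subvP => x; rewrite memv_cap => /andP[].
  by case/mem_limg=> y <-; rewrite memv_ker pi memv0 => /eqP->; rewrite linear0.
- case: X0; apply/zero_rmodP => x; apply: iI; apply/eqP.
  by rewrite -memv0 -(eqP l0) memv_img ?memvf.
- exists i; split=> // y; exists (p y); apply: (injP ((inj_lker p).2 k0)).
  by rewrite pi.
Qed.

(** The identity of X is the sum of its composites through the [F j], and by locality of End(X) one
    of them is invertible. The [F j] are arbitrary here; the case of copies of A is the one needed
    for projectives. *)
Lemma indec_retract_dsum X M k (F : 'I_k -> rmod A) (i : rhom X M) (p : rhom M X) :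
  retract i p -> indecomposable X -> dsum F M ->
  exists j (u : rhom X (F j)) v, retract u v.
Proof.
move=> pi Xi [I [P [e1 e2 es]]].
have [|j jI] := @noninj_sum X _ (fun j => hcomp (hcomp p (I j)) (hcomp (P j) i)) Xi.
  move=> x; rewrite homE => e.
  rewrite -(pi x) -[i x]es linear_sum -[RHS]e; apply: eq_bigr => j _.
  by rewrite !homE.
have [w ww] := retract_of_inj jI.
by exists j, (hcomp (P j) i), (hcomp w (hcomp p (I j))).
Qed.

Lemma krull_schmidt X M k (F : 'I_k -> rmod A) (i : rhom X M) (p : rhom M X) :
  retract i p -> indecomposable X -> dsum F M -> (forall j, indecomposable (F j)) ->
  exists j, iso X (F j).
Proof.
move=> pi Xi Fd Fi; have [j [u [v uv]]] := indec_retract_dsum pi Xi Fd.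
by exists j; apply: indec_retract_iso uv _ (Fi j); case: Xi.
Qed.

Lemma indec_iso M N : iso M N -> indecomposable M -> indecomposable N.
Proof.
move=> MN [M0 Mi]; have [f [fI fS]] := MN; have [g [gf fg]] := inv_exists fI fS.
apply: indec_of_sum2.
  move=> /zero_rmodP N0; apply: M0; apply/zero_rmodP => x.
  by apply: fI; exact: N0.
move=> X Y [i1 [i2 [p1 [p2 [e11 e22 e12 e21 es]]]]].
have [X0|X0] := pselect (zero_rmod X); [by left | right].
have [|h [hI hS]] := @indec_retract_iso X M (hcomp g i1) (hcomp p1 f) _ X0 (conj M0 Mi).
  by move=> x; rewrite !homE fg.
apply/zero_dim; have := sum2_dim (ex_intro _ i1 (ex_intro _ i2
  (ex_intro _ p1 (ex_intro _ p2 (And5 e11 e22 e12 e21 es))))).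
have d1 : dimM X = dimM M by apply/eqP; rewrite eqn_leq (inj_dim hI) (surj_dim hS).
have d2 : dimM N = dimM M by apply/eqP; rewrite eqn_leq (inj_dim fI) (surj_dim fS).
by rewrite d1 d2 => /eqP; rewrite -{1}[dimM M]addn0 eqn_add2l => /eqP.
Qed.

Lemma representatives k (F : 'I_k -> rmod A) (p : rmod A -> Prop) :
  (forall X Y, iso X Y -> p X -> p Y) ->
  exists m (s : 'I_m -> 'I_k), [/\ forall j, p (F (s j)),
    forall j l, iso (F (s j)) (F (s l)) -> j = l &
    forall i, p (F i) -> exists j, iso (F i) (F (s j))].
Proof.
move=> p_iso.
(* Each isomorphism class is represented by its least index. *)
pose D := [pred i : 'I_k | `[< p (F i) >] &&
  [forall j : 'I_k, (j < i)%N ==> ~~ `[< iso (F i) (F j) >]]].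
exists #|D|, (fun j => enum_val j); split=> [j|j l jl|i pi].
- by have := enum_valP j; rewrite inE => /andP[/asboolP].
- apply/enum_val_inj/val_inj => /=.
  have := enum_valP j; have := enum_valP l; rewrite !inE.
  move=> /andP[_ /forallP Hl] /andP[_ /forallP Hj].
  case: (ltngtP (enum_val j) (enum_val l)) => // lt.
    by have /implyP/(_ lt)/negP[] := Hl (enum_val j); apply/asboolP/iso_sym.
  by have /implyP/(_ lt)/negP[] := Hj (enum_val l); apply/asboolP.
pose P (m : nat) := `[< exists2 j : 'I_k, m = j & iso (F i) (F j) >].
have exP : exists m, P m by exists i; apply/asboolP; exists i => //; exact: iso_refl.
case: (ex_minnP exP) => _ /asboolP[j -> ij] jmin.
have jD : j \in D.
  rewrite inE; apply/andP; split; first by apply/asboolP; exact: p_iso ij pi.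
  apply/forallP => l; apply/implyP => lj; apply/negP => /asboolP jl.
  have := jmin l; rewrite leqNgt lj => H; suff: false by [].
  apply: H; apply/asboolP; exists l => //.
  exact: iso_trans ij jl.
by exists (enum_rank_in jD j); rewrite enum_rankK_in.
Qed.

End Decomposition.

(** * Dimensions of Hom spaces and traces *)

Section LinearAlgebra.
Variable K : fieldType.

Lemma lfun_exists (V W : vectType K) (f : V -> W) : linear f ->
  exists F : 'Hom(V, W), forall x, F x = f x.
Proof.
move=> f_lin; pose m := GRing.isSemilinear.Build K _ _ _ f (GRing.semilinear_linear f_lin).
pose L : {linear V -> W} := HB.pack f m.
by exists (linfun f) => x; exact: (lfunE L).
Qed.

Lemma vspace_of_pred (V : vectType K) (P : V -> Prop) : P 0 ->
  (forall c x y, P x -> P y -> P (c *: x + y)) ->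
  exists W : {vspace V}, forall x, x \in W <-> P x.
Proof.
move=> P0 PD.
(* A subspace of largest dimension inside [P] contains every vector of [P], since otherwise a line
   could be added to it. *)
pose Q d := `[< exists2 W : {vspace V}, d = \dim W & forall x, x \in W -> P x >].
have exQ : exists d, Q d.
  exists (\dim (0 : {vspace V})); apply/asboolP; exists 0%VS => // x.
  by rewrite memv0 => /eqP->.
have Qle d : Q d -> (d <= \dim {:V})%N.
  by move=> /asboolP[W -> _]; exact/dimvS/subvf.
case: (ex_maxnP exQ Qle) => _ /asboolP[W -> WP] Wmax.
exists W => x; split=> [/WP|Px] //.
have Qx : Q (\dim (<[x]> + W)).
  apply/asboolP; exists (<[x]> + W)%VS => // y /memv_addP[_ /vlineP[c ->] [w wW ->]].
  exact/PD/WP.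
suff /eqP-> : W == (<[x]> + W)%VS by rewrite (subvP (addvSl _ _)) // memv_line.
by rewrite eqEdim addvSr Wmax.
Qed.

End LinearAlgebra.

Section HomDim.
Variables (K : fieldType) (A : falgType K).
Implicit Types M N P Q X Y Z R : rmod A.

Definition hdim M N := \dim (homs M N).

Lemma homsP M N (f : 'Hom(M, N)) : f \in homs M N <-> exists h : rhom M N, hom_val h = f.
Proof.
rewrite mem_homs; split=> [fH|[h <-]]; last exact: homP.
by exists (RHom fH).
Qed.

Lemma homs_of_pred M N (P : rhom M N -> Prop) : P (hzero M N) ->
  (forall f g : rhom M N, (forall x, f x = g x) -> P f -> P g) ->
  (forall c f g, P f -> P g -> P (hadd (hscale c f) g)) ->
  exists S : {vspace 'Hom(M, N)}, (S <= homs M N)%VS /\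
    forall f : rhom M N, hom_val f \in S <-> P f.
Proof.
move=> P0 PE PD; pose Q (phi : 'Hom(M, N)) := exists2 h : rhom M N, hom_val h = phi & P h.
have [||S SE] := vspace_of_pred (P := Q).
- by exists (hzero M N).
- by move=> c _ _ [f <- Pf] [g <- Pg]; exists (hadd (hscale c f) g) => //; exact: PD.
exists S; split=> [|f].
  by apply/subvP => phi /SE[h <- _]; apply/homsP; exists h.
rewrite SE; split=> [[g e Pg]|Pf]; last by exists f.
by apply: PE Pg => x; rewrite e.
Qed.

(** Rank-nullity for Hom(X, R) -> Hom(X, M). The image [S] is a parameter because the uses differ:
    all of Hom when X is projective, zero in [hdim_sub], the radical maps in
    [hom_dim_independent]. *)
Lemma hdim_post X N R M (i : rhom N R) (g : rhom R M) (S : {vspace 'Hom(X, M)}) :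
  inj i -> (forall x, g x = 0 <-> exists y, i y = x) -> (S <= homs X M)%VS ->
  (forall f : rhom X M, hom_val f \in S <-> exists h : rhom X R, forall x, g (h x) = f x) ->
  hdim X R = (hdim X N + \dim S)%N.
Proof.
move=> iI iE SH SE.
have [|Lg LgE] := @lfun_exists K 'Hom(X, R) 'Hom(X, M) (fun f => (hom_val g \o f)%VF).
  by move=> c f1 f2; rewrite comp_lfunDr -comp_lfunZr.
have [|Li LiE] := @lfun_exists K 'Hom(X, N) 'Hom(X, R) (fun f => (hom_val i \o f)%VF).
  by move=> c f1 f2; rewrite comp_lfunDr -comp_lfunZr.
rewrite /hdim -(limg_ker_dim Lg (homs X R)); congr addn.
- have -> : (homs X R :&: lker Lg)%VS = (Li @: homs X N)%VS.
    apply/vspaceP => phi; apply/idP/idP.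
      rewrite memv_cap memv_ker => /andP[/homsP[h <-] /eqP/lfunP gh].
      have [|k kE] := factor_inj (f := h) iI.
        move=> x; have [|y <-] := (iE (h x)).1; last by exists y.
        by have := gh x; rewrite LgE comp_lfunE zero_lfunE.
      have -> : hom_val h = Li (hom_val k).
        by apply/lfunP => x; rewrite LiE comp_lfunE kE.
      by apply: memv_img; apply/homsP; exists k.
    case/memv_imgP=> _ /homsP[k <-] ->; rewrite memv_cap memv_ker; apply/andP; split.
      by apply/homsP; exists (hcomp i k); rewrite LiE.
    apply/eqP/lfunP => x; rewrite LgE comp_lfunE LiE comp_lfunE zero_lfunE.
    by apply/iE; exists (k x).
  rewrite limg_dim_eq //; apply/eqP; rewrite -subv0; apply/subvP => f.
  rewrite memv_cap memv_ker LiE => /andP[_ /eqP/lfunP z].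
  rewrite memv0; apply/eqP/lfunP => x; rewrite zero_lfunE; apply: iI.
  by have := z x; rewrite comp_lfunE !zero_lfunE.
- suff -> : (Lg @: homs X R)%VS = S by [].
  apply/vspaceP => phi; apply/idP/idP.
    case/memv_imgP=> _ /homsP[h <-] ->; rewrite LgE.
    by apply/(SE (hcomp g h)); exists h => x; rewrite homE.
  move=> phiS; have /homsP[f fE] := subvP SH _ phiS.
  have [h hE] := (SE f).1 (etrans (congr1 (fun z => z \in S) fE) phiS).
  have -> : phi = Lg (hom_val h).
    by apply/lfunP => x; rewrite LgE comp_lfunE hE fE.
  by apply: memv_img; apply/homsP; exists h.
Qed.

Lemma hdim_pre X P1 P0 M (d : rhom P1 P0) (e : rhom P0 M) (S : {vspace 'Hom(P1, X)}) :
  surj e -> (forall x, e x = 0 <-> exists y, d y = x) -> (S <= homs P1 X)%VS ->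
  (forall f : rhom P1 X, hom_val f \in S <-> exists h : rhom P0 X, forall x, h (d x) = f x) ->
  hdim P0 X = (hdim M X + \dim S)%N.
Proof.
move=> eS eE SH SE.
have [|Ld LdE] := @lfun_exists K 'Hom(P0, X) 'Hom(P1, X) (fun f => (f \o hom_val d)%VF).
  by move=> c f1 f2; rewrite comp_lfunDl -comp_lfunZl.
have [|Le LeE] := @lfun_exists K 'Hom(M, X) 'Hom(P0, X) (fun f => (f \o hom_val e)%VF).
  by move=> c f1 f2; rewrite comp_lfunDl -comp_lfunZl.
rewrite /hdim -(limg_ker_dim Ld (homs P0 X)); congr addn.
- have -> : (homs P0 X :&: lker Ld)%VS = (Le @: homs M X)%VS.
    apply/vspaceP => phi; apply/idP/idP.
      rewrite memv_cap memv_ker => /andP[/homsP[h <-] /eqP/lfunP hd].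
      have [|k kE] := factor_surj (f := h) eS.
        move=> x /eE[y <-]; have := hd y.
        by rewrite LdE comp_lfunE zero_lfunE.
      have -> : hom_val h = Le (hom_val k).
        by apply/lfunP => x; rewrite LeE comp_lfunE kE.
      by apply: memv_img; apply/homsP; exists k.
    case/memv_imgP=> _ /homsP[k <-] ->; rewrite memv_cap memv_ker; apply/andP; split.
      by apply/homsP; exists (hcomp k e); rewrite LeE.
    apply/eqP/lfunP => x; rewrite LdE comp_lfunE LeE comp_lfunE zero_lfunE.
    have -> : e (d x) = 0 by apply/eE; exists x.
    by rewrite linear0.
  rewrite limg_dim_eq //; apply/eqP; rewrite -subv0; apply/subvP => f.
  rewrite memv_cap memv_ker LeE => /andP[_ /eqP/lfunP z].
  rewrite memv0; apply/eqP/lfunP => y; have [x <-] := eS y.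
  by have := z x; rewrite comp_lfunE !zero_lfunE.
- suff -> : (Ld @: homs P0 X)%VS = S by [].
  apply/vspaceP => phi; apply/idP/idP.
    case/memv_imgP=> _ /homsP[h <-] ->; rewrite LdE.
    by apply/(SE (hcomp h d)); exists h => x; rewrite homE.
  move=> phiS; have /homsP[f fE] := subvP SH _ phiS.
  have [h hE] := (SE f).1 (etrans (congr1 (fun z => z \in S) fE) phiS).
  have -> : phi = Ld (hom_val h).
    by apply/lfunP => x; rewrite LdE comp_lfunE hE fE.
  by apply: memv_img; apply/homsP; exists h.
Qed.

Lemma hdim0 M N : (forall (f : rhom M N) x, f x = 0) <-> hdim M N = 0%N.
Proof.
split=> [z|/eqP].
  apply/eqP; rewrite dimv_eq0 -subv0; apply/subvP => _ /homsP[f <-].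
  by rewrite memv0; apply/eqP/lfunP => x; rewrite z zero_lfunE.
rewrite dimv_eq0 => /eqP z f x.
have : hom_val f \in homs M N by apply/homsP; exists f.
by rewrite z memv0 => /eqP->; rewrite zero_lfunE.
Qed.

Lemma hdim_sub X N M (i : rhom N M) : inj i ->
  (forall f : rhom X M, exists g : rhom X N, forall x, i (g x) = f x) ->
  hdim X M = hdim X N.
Proof.
move=> iI iF; have [Q [p [pS pE]]] := coker_exists i.
rewrite (@hdim_post X N M Q i p 0%VS) ?dimv0 ?addn0 ?sub0v // => f.
rewrite memv0; split=> [/eqP f0|[h hE]].
  by exists (hzero X M) => x; rewrite homE linear0 f0 zero_lfunE.
apply/eqP/lfunP => x; rewrite -hE zero_lfunE; apply/pE.
by have [g gE] := iF h; exists (g x).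
Qed.

Lemma hdim_sum2l X M N S : is_sum2 M N S -> hdim S X = (hdim M X + hdim N X)%N.
Proof.
move=> [i1 [i2 [p1 [p2 [e11 e22 e12 e21 es]]]]].
apply: (@hdim_pre X N S M i2 p1 (homs N X)) => //.
- by move=> x; exists (i1 x).
- move=> x; split=> [e|[y <-]] //; exists (p2 x).
  by rewrite -[RHS]es e linear0 add0r.
- move=> f; split=> [_|_]; last by apply/homsP; exists f.
  by exists (hcomp f p2) => x; rewrite homE e22.
Qed.

Lemma hdim_isol M N X : iso M N -> hdim M X = hdim N X.
Proof.
move=> [f [fI fS]]; have [g [gf fg]] := inv_exists fI fS.
have [Z /zero_rmodP Z0] := zero_exists A.
rewrite (@hdim_pre X Z M N (hzero Z M) f 0%VS) ?dimv0 ?addn0 ?sub0v //.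
- move=> x; split=> [/fI->|[y <-]]; last by rewrite homE linear0.
  by exists 0; rewrite homE.
- move=> h; rewrite memv0; split=> [_|_].
    by exists (hzero M X) => x; rewrite (Z0 x) !linear0.
  by apply/eqP/lfunP => x; rewrite (Z0 x) !linear0.
Qed.

(** The trace of N in X as the set of finite sums of images of maps N -> X. With it [Gen N X]
    expresses that X is a quotient of some N^k without fixing such a surjection. *)
Inductive in_trace N X : X -> Prop :=
| in_trace0 : in_trace N 0
| in_traceD (f : rhom N X) y x : in_trace N x -> in_trace N (f y + x).

Definition Gen N X := forall x : X, in_trace N x.

Lemma in_trace_im N X (f : rhom N X) y : in_trace N (f y).
Proof. by rewrite -[f y]addr0; apply/in_traceD/in_trace0. Qed.

Lemma in_trace_add N X (x y : X) : in_trace N x -> in_trace N y -> in_trace N (x + y).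
Proof.
move=> xt yt; elim: xt => [|f z x' _ IH]; first by rewrite add0r.
by rewrite -addrA; apply: in_traceD.
Qed.

Lemma in_trace_hom N X Y (g : rhom X Y) x : in_trace N x -> in_trace N (g x).
Proof.
elim=> [|f y z _ IH]; first by rewrite linear0; exact: in_trace0.
by rewrite linearD /= -[g (f y)](hcompE g f); exact: in_traceD.
Qed.

Lemma in_trace_scale N X c (x : X) : in_trace N x -> in_trace N (c *: x).
Proof. by move=> /(in_trace_hom (hscale c (hid X))); rewrite !homE. Qed.

Lemma in_trace_ract N X a (x : X) : in_trace N x -> in_trace N (ract X a x).
Proof.
elim=> [|f y z _ IH]; first by rewrite linear0; exact: in_trace0.
by rewrite linearD /= -hom_ract; exact: in_traceD.
Qed.

Lemma gen_refl N : Gen N N.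
Proof. by move=> x; rewrite -(hidE x); exact: in_trace_im. Qed.

Lemma gen_surj N X Q (p : rhom X Q) : surj p -> Gen N X -> Gen N Q.
Proof. by move=> pS G y; have [x <-] := pS y; exact: in_trace_hom. Qed.

Lemma gen_trans N M X : Gen N M -> Gen M X -> Gen N X.
Proof.
move=> NM MX x; elim: (MX x) => [|f y z _ IH]; first exact: in_trace0.
by apply: in_trace_add => //; exact: in_trace_hom.
Qed.

Lemma gen_iso N X Y : iso X Y -> Gen N X -> Gen N Y.
Proof. by move=> [f [_ fS]]; exact: gen_surj. Qed.

Lemma gen_zero N X : zero_rmod X -> Gen N X.
Proof. by move=> /zero_rmodP z x; rewrite (z x); exact: in_trace0. Qed.

Lemma gen_sum2 N X Y M : is_sum2 X Y M -> Gen N X -> Gen N Y -> Gen N M.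
Proof.
move=> [i1 [i2 [p1 [p2 [e11 e22 e12 e21 es]]]]] GX GY x.
by rewrite -(es x); apply: in_trace_add; exact: in_trace_hom.
Qed.

Lemma gen_hom0 N X Z (g : rhom X Z) : Gen N X ->
  (forall (f : rhom N X) y, g (f y) = 0) -> forall x, g x = 0.
Proof.
move=> G g0 x; elim: (G x) => [|f y z _ IH]; first exact: linear0.
by rewrite linearD /= IH addr0 g0.
Qed.

Lemma trace_exists N X : exists T (i : rhom T X), [/\ inj i,
  forall x, in_trace N x <-> exists y, i y = x, Gen N T &
  forall f : rhom N X, exists g : rhom N T, forall x, i (g x) = f x].
Proof.
have [|W WE] := @vspace_of_pred K X (@in_trace N X) (in_trace0 _ _).
  by move=> c x y xt yt; apply: in_trace_add => //; exact: in_trace_scale.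
have Ws : submodule W.
  move=> a; apply/subvP => _ /memv_imgP[x /WE xW ->].
  by apply/WE; exact: in_trace_ract.
have [T [i [iI iE]]] := submodule_exists Ws.
have iF (f : rhom N X) : exists g : rhom N T, forall x, i (g x) = f x.
  by apply: factor_inj => // x; have [|y <-] := (iE (f x)).1; [exact/WE/in_trace_im | exists y].
exists T, i; split=> // [x|y]; first by rewrite -iE WE.
suff H (x : X) : in_trace N x -> forall y, i y = x -> in_trace N y.
  by apply: (H (i y)) => //; apply/WE/iE; exists y.
elim=> [|f z {}x xt IH] {}y e.
  have -> : y = 0 by exact: iI.
  exact: in_trace0.
have [g gE] := iF f.
have e2 : i (y - g z) = x by rewrite linearB /= gE e addrAC subrr add0r.
by rewrite -[y](subrK (g z)) addrC; apply: in_traceD; exact: IH.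
Qed.

(** Finite direct sums of modules in [p], in a form suited to induction that carries no index
    set. *)
Inductive add_hull (p : rmod A -> Prop) : rmod A -> Prop :=
| add_hull0 M : zero_rmod M -> add_hull p M
| add_hullS X N M : p X -> is_sum2 X N M -> add_hull p N -> add_hull p M.

Lemma dsum_uncons k (F : 'I_k.+1 -> rmod A) M : dsum F M ->
  exists2 N, is_sum2 (F ord0) N M & dsum (fun j => F (lift ord0 j)) N.
Proof.
move=> [i [p [pi pi0 ip]]].
have [N [i2 [p2 H]]] := @retract_sum2 K A _ M (i ord0) (p ord0) (pi ord0).
exists N; first by exists (i ord0), i2, (p ord0), p2.
case: H => e11 e22 e12 e21 es.
exists (fun j => hcomp p2 (i (lift ord0 j))), (fun j => hcomp (p (lift ord0 j)) i2).
have i2p2 j x : i2 (p2 (i (lift ord0 j) x)) = i (lift ord0 j) x.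
  by rewrite -[RHS]es pi0 ?linear0 ?add0r // eq_sym neq_lift.
split=> [j x|j l x jl|x]; rewrite ?homE ?i2p2 //; first by rewrite pi0 // (inj_eq lift_inj).
rewrite -[RHS]e22 -[i2 x]ip big_ord_recl linearD /= e12 add0r linear_sum.
by apply: eq_bigr => j _; rewrite !homE.
Qed.

Lemma dsum_add_hull k (F : 'I_k -> rmod A) M (p : rmod A -> Prop) :
  dsum F M -> (forall j, p (F j)) -> add_hull p M.
Proof.
elim: k F M => [|k IH] F M Fd Fp.
  apply: add_hull0; apply/zero_rmodP => x; case: Fd => i [q [_ _ es]].
  by rewrite -(es x) big_ord0.
have [N S Nd] := dsum_uncons Fd; apply: add_hullS (Fp ord0) S _.
by apply: IH Nd _ => j.
Qed.

Lemma add_hull_sub (p q : rmod A -> Prop) M : (forall X, p X -> q X) -> add_hull p M -> add_hull q M.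
Proof.
by move=> pq; elim=> [X|X N {}M pX S _ IH]; [exact: add_hull0 | exact: add_hullS (pq _ pX) S IH].
Qed.

Lemma gen_add_hull N M : add_hull (Gen N) M -> Gen N M.
Proof.
elim=> [X|X Y {}M GX S _ GY]; [exact: gen_zero | exact: gen_sum2 S GX GY].
Qed.

Lemma gen_dsum_l k (F : 'I_k -> rmod A) M j : dsum F M -> Gen M (F j).
Proof.
move=> [i [p [pi _ _]]].
by apply: (@gen_surj M M _ (p j)); [move=> x; exists (i j x) | exact: gen_refl].
Qed.

Lemma gen_dsum k (F : 'I_k -> rmod A) M N : dsum F M -> (forall j, Gen N (F j)) -> Gen N M.
Proof. by move=> Fd FG; apply/gen_add_hull/(dsum_add_hull Fd). Qed.

(* Among the maps [g : R -> X] satisfying [P], take one through which the largest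
   space of maps factors. *)
Lemma precover k (F : 'I_k -> rmod A) X (P : forall R, rhom R X -> Prop) :
  (forall Z g, zero_rmod Z -> P Z g) ->
  (forall j (f : rhom (F j) X) R g S (i1 : rhom (F j) S) (i2 : rhom R S) p1 p2,
     sum2 i1 i2 p1 p2 -> P _ f -> P R g -> P S (hadd (hcomp f p1) (hcomp g p2))) ->
  exists R (g : rhom R X), [/\ add_hull (fun Y => exists j, Y = F j) R, P R g &
    forall j (f : rhom (F j) X), P _ f -> exists h : rhom (F j) R, forall x, g (h x) = f x].
Proof.
move=> P0 PS.
have factS R (g : rhom R X) Y : exists S : {vspace 'Hom(Y, X)}, (S <= homs Y X)%VS /\
    forall f : rhom Y X, hom_val f \in S <-> exists h : rhom Y R, forall x, g (h x) = f x.
  apply: homs_of_pred => [|f1 f2 e [h hE]|c f1 f2 [h1 h1E] [h2 h2E]].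
  - by exists (hzero Y R) => x; rewrite !homE linear0.
  - by exists h => x; rewrite -e.
  - by exists (hadd (hscale c h1) h2) => x; rewrite !homE linearP /= h1E h2E.
pose Q n := `[< exists R (g : rhom R X) (S : forall j, {vspace 'Hom(F j, X)}),
  [/\ add_hull (fun Y => exists j, Y = F j) R, P R g,
      forall j, (S j <= homs (F j) X)%VS,
      forall j (f : rhom (F j) X), hom_val f \in S j <->
        exists h : rhom (F j) R, forall x, g (h x) = f x &
      n = (\sum_j \dim (S j))%N] >].
have mkQ R (g : rhom R X) : exists S : forall j, {vspace 'Hom(F j, X)},
    (forall j, (S j <= homs (F j) X)%VS) /\
      forall j (f : rhom (F j) X), hom_val f \in S j <->
        exists h : rhom (F j) R, forall x, g (h x) = f x.
  pose S j := projT1 (cid (factS R g (F j))).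
  by exists S; split=> j; have [] := projT2 (cid (factS R g (F j))).
have exQ : exists n, Q n.
  have [Z Z0] := zero_exists A; have [S [S1 S2]] := mkQ Z (hzero Z X).
  exists (\sum_j \dim (S j))%N; apply/asboolP; exists Z, (hzero Z X), S.
  by split=> //; [exact: add_hull0 | exact: P0].
have Qle n : Q n -> (n <= \sum_j hdim (F j) X)%N.
  by move=> /asboolP[R [g [S [_ _ S1 _ ->]]]]; apply: leq_sum => j _; exact: dimvS.
case: (ex_maxnP exQ Qle) => n /asboolP[R [g [S [RA Pg S1 S2 nE]]]] nmax.
exists R, g; split=> // j f Pf; apply: contrapT => nf.
(* If [f] did not factor through [g], then adding [F j] as a summand of the source would strictly
   enlarge the space of factoring maps from [F j] and shrink no other, against maximality of [n]. *)
have [M [i1 [i2 [p1 [p2 H]]]]] := sum2_exists (F j) R.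
have [e11 e22 e12 e21 _] := H.
pose g' := hadd (hcomp f p1) (hcomp g p2).
have [S' [S1' S2']] := mkQ M g'.
have SS' l : (S l <= S' l)%VS.
  apply/subvP => phi phiS; have /homsP[f' f'E] := subvP (S1 l) _ phiS.
  subst phi; have [h hE] := (S2 l f').1 phiS.
  apply/S2'; exists (hcomp i2 h) => x.
  by rewrite !homE e21 e22 linear0 add0r.
have : (\sum_l \dim (S' l) <= n)%N.
  apply: nmax; apply/asboolP; exists M, g', S'; split=> //; last exact: PS H Pf Pg.
  by apply: add_hullS RA; [exists j | exists i1, i2, p1, p2].
rewrite nE leqNgt => /negP; apply.
rewrite (bigD1 j) //= [X in (_ < X)%N](bigD1 j) //= -addSn leq_add //; last first.
  by apply: leq_sum => l _; exact: dimvS.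
rewrite ltnNge; apply/negP => le; apply: nf; apply/S2.
have /eqP-> : S j == S' j by rewrite eqEdim SS' le.
by apply/S2'; exists i1 => x; rewrite !homE e11 e12 linear0 addr0.
Qed.

(** The argument imitates an almost split sequence inside Gen N: [g : R -> F i] approximates the
    radical maps into [F i], and its kernel is replaced by the trace [T]. The relation at [F i], [T]
    and [R] leaves only [c i] times the codimension of the radical in End(F i), since for j
    different from i every map [F j -> F i] is radical. *)
Lemma hom_dim_independent m (F : 'I_m -> rmod A) N (c : 'I_m -> rat) :
  (forall j, indecomposable (F j)) -> pairwise_non_iso F -> dsum F N ->
  (forall Y, Gen N Y -> \sum_j c j * (hdim (F j) Y)%:R = 0) ->
  forall j, c j = 0.
Proof.
move=> Fi Fn Fd cF i.
(* The radical maps into [F i]: those that no map [a] splits up to an automorphism of [F i]. *)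
pose rad X (h : rhom X (F i)) := forall a : rhom (F i) X, ~ inj (hcomp h a).
have rad_ext X (f g : rhom X (F i)) : (forall x, f x = g x) -> rad X f -> rad X g.
  by move=> e fr a aI; apply: (fr a) => x; rewrite homE e -(hcompE g a) => /aI.
have zero_rad X (f : rhom X (F i)) : (forall x, f x = 0) -> rad X f.
  move=> f0 a aI; case: (Fi i) => /nonzero_rmodP[x xn0] _; apply/xn0/aI.
  by rewrite homE f0.
have add_rad X (f g : rhom X (F i)) : rad X f -> rad X g -> rad X (hadd f g).
  move=> fr gr a aI; apply: (noninj_add (Fi i) (fr a) (gr a)) => x e.
  by apply: aI; rewrite -[RHS]e !homE.
have comp_rad X Y (f : rhom X (F i)) (h : rhom Y X) : rad X f -> rad Y (hcomp f h).
  move=> fr a aI; apply: (fr (hcomp h a)) => x e; apply: aI.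
  by rewrite -[RHS]e !homE.
have scale_rad X (f : rhom X (F i)) b : rad X f -> rad X (hscale b f).
  move=> fr; have := comp_rad _ _ _ (hscale b (hid X)) fr; apply: rad_ext => x.
  by rewrite !homE linearZ.
have [||R [g [RA gr gF]]] := @precover m F (F i) rad.
- by move=> Z g /zero_rmodP Z0; apply: zero_rad => x; rewrite (Z0 x) linear0.
- by move=> j f R g S i1 i2 p1 p2 _ fr gr; apply: add_rad; exact: comp_rad.
have radS j : exists S : {vspace 'Hom(F j, F i)}, (S <= homs (F j) (F i))%VS /\
    forall f : rhom (F j) (F i), hom_val f \in S <-> rad (F j) f.
  apply: homs_of_pred => [|f1 f2|b f1 f2 r1 r2]; last exact/add_rad/r2/scale_rad.
    by apply: zero_rad => x; rewrite homE.
  exact: rad_ext.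
have [L [iL [iLI iLE]]] := ker_exists g.
have [T [t [tI tE TG tF]]] := trace_exists N L.
pose S j := projT1 (cid (radS j)).
have [S1 S2] : (forall j, (S j <= homs (F j) (F i))%VS) /\
    forall j (f : rhom (F j) (F i)), hom_val f \in S j <-> rad (F j) f.
  by split=> j; have [] := projT2 (cid (radS j)).
have dimE j : hdim (F j) R = (hdim (F j) T + \dim (S j))%N.
  rewrite -(@hdim_sub (F j) T L t tI).
    apply: (@hdim_post _ _ _ _ iL g) => // f; rewrite S2; split=> [/gF|[h hE]] //.
    by apply: rad_ext (comp_rad _ _ _ h gr) => x; rewrite homE hE.
  move=> f; case: Fd => I [P [PI _ _]].
  have [h hE] := tF (hcomp f (P j)).
  by exists (hcomp h (I j)) => x; rewrite homE hE homE PI.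
have GF j : Gen N (F j) by exact: gen_dsum_l Fd.
have GR : Gen N R.
  by apply: gen_add_hull; apply: add_hull_sub RA => _ [j ->].
have /eqP := cF _ GR; have := cF _ (GF i); have := cF _ TG.
set sT := \sum_j _ => sT0; set sF := \sum_j _ => sF0.
have -> : \sum_j c j * (hdim (F j) R)%:R = sT + \sum_j c j * (\dim (S j))%:R.
  rewrite -big_split; apply: eq_bigr => j _ /=.
  by rewrite dimE natrD mulrDr.
rewrite sT0 add0r => /eqP sS0.
have e : sF = c i * (hdim (F i) (F i) - \dim (S i))%:R + \sum_j c j * (\dim (S j))%:R.
  rewrite /sF (bigD1 i) //= [in RHS](bigD1 i) //= addrA -mulrDr -natrD subnK; last exact: dimvS.
  congr (_ + _); apply: eq_bigr => j ji; congr (_ * (\dim _)%:R).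
  apply/eqP; rewrite eqEsubv S1 andbT; apply/subvP => _ /homsP[f <-].
  apply/S2 => a aI; have [w ww] := retract_of_inj aI.
  have ij := indec_retract_iso ww (Fi i).1 (Fi j).
  by move: ji; rewrite (Fn i j) ?eqxx //; exact/isoP.
move: sF0; rewrite e sS0 addr0 => /eqP; rewrite mulf_eq0 => /orP[/eqP //|].
rewrite pnatr_eq0 subn_eq0 => le; exfalso.
(* If the radical were all of End(F i), the identity of [F i] would be radical. *)
have eS : S i = homs (F i) (F i) by apply/eqP; rewrite eqEdim S1.
have : hom_val (hid (F i)) \in S i by rewrite eS; apply/homsP; exists (hid (F i)).
by move/S2/(_ (hid _)); apply=> x; rewrite !homE.
Qed.

End HomDim.

(** * Projective presentations *)

Section Projectives.
Variables (K : fieldType) (A : falgType K).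
Implicit Types M N P Q X Y Z R : rmod A.

Lemma ract_regular a (x : regular_rmod A) : ract (regular_rmod A) a x = (x : A) * a :> A.
Proof. by rewrite /= lfunE. Qed.

Lemma eval_hom M (x : M) : exists f : rhom (regular_rmod A) M, forall a, f a = ract M a x.
Proof.
apply: (@mk_rhom K A (regular_rmod A) M (fun a => ract M a x)).
  by move=> c a b; rewrite ract_linearl.
by move=> a b; rewrite ract_regular ractEM.
Qed.

Lemma projective_lift P X Y (g : rhom X Y) (h : rhom P Y) : projective P -> surj g ->
  exists l : rhom P X, forall x, g (l x) = h x.
Proof.
move=> PP /surj_limg gS; have [l lH /lfunP e] := PP X Y g h (homP g) gS (homP h).
by exists (RHom lH) => x; have := e x; rewrite comp_lfunE.
Qed.

Lemma projective_intro P : (forall X Y (g : rhom X Y) (h : rhom P Y), surj g ->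
  exists l : rhom P X, forall x, g (l x) = h x) -> projective P.
Proof.
move=> H X Y g h gH gS hH; have [|l lE] := H X Y (RHom gH) (RHom hH).
  exact/surj_limg.
by exists l; [exact: homP | apply/lfunP => x; rewrite comp_lfunE lE].
Qed.

Lemma projective_regular : projective (regular_rmod A).
Proof.
apply: projective_intro => X Y g h gS; have [x xE] := gS (h (1 : A)).
have [l lE] := eval_hom x; exists l => a.
by rewrite lE hom_ract xE -hom_ract ract_regular mul1r.
Qed.

Lemma projective_retract P Q (i : rhom Q P) (p : rhom P Q) :
  retract i p -> projective P -> projective Q.
Proof.
move=> pi PP; apply: projective_intro => X Y g h gS.
have [l lE] := projective_lift (hcomp h p) PP gS.
by exists (hcomp l i) => x; rewrite homE lE homE pi.
Qed.

Lemma projective_sum2 P Q S : is_sum2 P Q S -> projective P -> projective Q ->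
  projective S.
Proof.
move=> [i1 [i2 [p1 [p2 [e11 e22 e12 e21 es]]]]] PP QP.
apply: projective_intro => X Y g h gS.
have [l1 l1E] := projective_lift (hcomp h i1) PP gS.
have [l2 l2E] := projective_lift (hcomp h i2) QP gS.
exists (hadd (hcomp l1 p1) (hcomp l2 p2)) => x.
by rewrite !homE linearD /= l1E l2E !homE -linearD es.
Qed.

Lemma projective_zero Z : zero_rmod Z -> projective Z.
Proof.
move=> /zero_rmodP Z0; apply: projective_intro => X Y g h _; exists (hzero Z X) => x.
by rewrite (Z0 x) !linear0.
Qed.

Lemma projective_add_hull M : add_hull (@projective K A) M -> projective M.
Proof.
elim=> [X|X N {}M PX S _ PN]; [exact: projective_zero | exact: projective_sum2 S PX PN].
Qed.

Lemma free_cover M : exists k R (g : rhom R M),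
  dsum (fun _ : 'I_k => regular_rmod A) R /\ surj g.
Proof.
pose b := vbasis {:M}.
have [R [I [P [e1 e2 es]]]] := dsum_exists (fun _ : 'I_(\dim {:M}) => regular_rmod A).
pose ev (j : 'I_(\dim {:M})) := projT1 (cid (eval_hom b`_j)).
have evE j a : ev j a = ract M a b`_j by exact: (projT2 (cid (eval_hom b`_j))).
exists (\dim {:M}), R, (hsum (fun j => hcomp (ev j) (P j))).
split; first by exists I, P.
move=> x; exists (\sum_j I j (coord b j x *: 1)).
rewrite homE [RHS](coord_vbasis (memvf x)); apply: eq_bigr => j _.
rewrite homE linear_sum (bigD1 j) //= e1 big1 => [|l lj]; last by rewrite e2.
by rewrite addr0 evE linearZ scale_lfunE ractE1.
Qed.

Lemma projective_free k R : dsum (fun _ : 'I_k => regular_rmod A) R -> projective R.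
Proof.
by move=> Rd; apply/projective_add_hull/(dsum_add_hull Rd) => _; exact: projective_regular.
Qed.

Lemma gen_regular M : Gen (regular_rmod A) M.
Proof.
by move=> x; have [f fE] := eval_hom x; rewrite -(ractE1 x) -fE; exact: in_trace_im.
Qed.

Lemma indec_projective k (F : 'I_k -> rmod A) X : dsum F (regular_rmod A) ->
  (forall j, indecomposable (F j)) -> indecomposable X -> projective X ->
  exists j, iso X (F j).
Proof.
move=> Fd Fi Xi PX; have [q [R [g [Rd gS]]]] := free_cover X.
have [s sE] := projective_lift (hid X) PX gS.
have [|_ [u [v uv]]] := indec_retract_dsum (i := s) (p := g) _ Xi Rd.
  by move=> x; rewrite sE homE.
exact: krull_schmidt uv Xi Fd Fi.
Qed.

Lemma dual_basis P : projective P -> exists q (p : 'I_q -> P)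
  (h : 'I_q -> rhom P (regular_rmod A)), forall y, y = \sum_j ract P (h j y) (p j).
Proof.
move=> PP; have [q [R [g [[I [J [_ _ es]]] gS]]]] := free_cover P.
have [s sE] := projective_lift (hid P) PP gS.
exists q, (fun j => g (I j (1 : A))), (fun j => hcomp (J j) s) => y.
rewrite -[LHS]hidE -sE -[s y]es linear_sum; apply: eq_bigr => j _.
by rewrite homE -hom_ract -hom_ract ract_regular mul1r.
Qed.

(** * Projective covers, minimal presentations and their comparison *)

Definition is_cover P M (e : rhom P M) :=
  [/\ projective P, surj e & superfluous (lker e)].

(** The image of [f] together with the kernel of [e] fills P, so [f] is onto, and a surjective
    endomorphism is injective by dimension. *)
Lemma superfluousP P M (e : rhom P M) (f : rhom P P) : superfluous (lker e) ->
  (forall x, exists y, e (f y) = e x) -> inj f.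
Proof.
move=> es ef; apply: surj_inj => //; apply/surj_limg/es; first exact: submodule_limg.
apply/eqP; rewrite eqEsubv subvf; apply/subvP => x _; have [y yE] := ef x.
have -> : x = f y + (x - f y) by rewrite addrCA subrr addr0.
by rewrite memv_add ?memv_img ?memvf // memv_ker linearB /= yE subrr.
Qed.

(** A projective of least dimension mapping onto M is a cover. If W + ker e = P, lifting [e] through
    W gives an endomorphism [phi] over M with image in W. By Fitting a power of [phi] has as image a
    direct summand of P that still maps onto M; minimality makes it all of P, so W = P. *)
Lemma cover_exists M : exists P (e : rhom P M), is_cover e.
Proof.
pose Q n := `[< exists P (e : rhom P M), [/\ projective P, surj e & n = dimM P] >].
have exQ : exists n, Q n.
  have [k [R [g [Rd gS]]]] := free_cover M; exists (dimM R); apply/asboolP.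
  by exists R, g; split=> //; exact: projective_free Rd.
case: (ex_minnP exQ) => _ /asboolP[P [e [PP eS ->]]] Pmin.
exists P, e; split=> // W Ws We.
have [N [i [iI iE]]] := submodule_exists Ws.
have [|phi' phi'E] := @projective_lift P N M (hcomp e i) e PP.
  move=> y; have [x <-] := eS y; have : x \in (W + lker e)%VS by rewrite We memvf.
  case/memv_addP=> _ /iE[z <-] [k]; rewrite memv_ker => /eqP ek ->.
  by exists z; rewrite homE linearD /= ek addr0.
pose phi := hcomp i phi'.
have ephi x : e (phi x) = e x by rewrite homE -[RHS]phi'E homE.
have [n [h0 _]] := fitting phi; set h := hiter n.+1 phi in h0.
have eh x : e (h x) = e x.
  by rewrite hiterE; elim: n.+1 => //= m IH; rewrite ephi.
have [X [q [j [qS jI hE]]]] := im_factor h.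
have qjI : inj (hcomp q j).
  move=> x; rewrite homE => qjx; apply: jI; apply/eqP; rewrite -memv0 -h0.
  rewrite memv_cap memv_ker hE qjx linear0 eqxx andbT.
  by have [y <-] := qS x; rewrite -hE memv_img ?memvf.
have [w ww] := retract_of_inj qjI.
have jS : surj j.
  apply: (inj_surj jI); apply: Pmin; apply/asboolP; exists X, (hcomp e j).
  split=> //; first exact: projective_retract ww PP.
  by move=> y; have [x <-] := eS y; exists (q x); rewrite homE -hE eh.
apply/eqP; rewrite eqEsubv subvf; apply/subvP => x _.
have [y yE] := jS x; have [z zE] := qS y.
by apply/iE; exists (phi' (iter n phi z)); rewrite -yE -zE -hE hiterE /= homE.
Qed.

Definition presentation P1 P0 M (d : rhom P1 P0) (e : rhom P0 M) :=
  [/\ projective P1, projective P0, surj e & forall x, e x = 0 <-> exists y, d y = x].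

Definition minpres P1 P0 M (d : rhom P1 P0) (e : rhom P0 M) :=
  [/\ presentation d e, superfluous (lker e) & superfluous (lker d)].

(* For a minimal presentation d of M this says that [Hom(X, tau M) = 0]. *)
Definition extends P1 P0 (d : rhom P1 P0) X :=
  forall h : rhom P1 X, exists u : rhom P0 X, forall x, u (d x) = h x.

(** No minimality is asked of the presentation, so that direct sums of presentations qualify
    directly; [rigid_on_retract] recovers minimal ones. *)
Definition rigid_on (T : rmod A -> Prop) M :=
  exists P1 P0 (d : rhom P1 P0) (e : rhom P0 M), presentation d e /\ forall X, T X -> extends d X.

Lemma minpres_exists M : exists P1 P0 (d : rhom P1 P0) (e : rhom P0 M), minpres d e.
Proof.
have [P0 [e [PP0 eS es]]] := cover_exists M.
have [L [i [iI iE]]] := ker_exists e.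
have [P1 [c [PP1 cS cs]]] := cover_exists L.
exists P1, P0, (hcomp i c), e; split=> //.
  split=> // x; rewrite iE; split=> [[y <-]|[y <-]]; last by rewrite homE; exists (c y).
  by have [z <-] := cS y; exists z; rewrite homE.
suff -> : lker (hcomp i c) = lker c by [].
apply/vspaceP => x; rewrite !memv_ker homE; apply/eqP/eqP => [/iI|->] //.
by rewrite linear0.
Qed.

Lemma lift_ker P1 P0 M (d : rhom P1 P0) (e : rhom P0 M) Q (f : rhom Q P0) :
  presentation d e -> projective Q -> (forall x, e (f x) = 0) ->
  exists l : rhom Q P1, forall x, d (l x) = f x.
Proof.
move=> [PP1 PP0 eS eE] PQ ef0; have [L [i [iI iE]]] := ker_exists e.
have [|d' d'E] := factor_inj (f := d) iI.
  by move=> x; have [|y <-] := (iE (d x)).1; [apply/eE; exists x | exists y].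
have [|f' f'E] := factor_inj (f := f) iI.
  by move=> x; have [|y <-] := (iE (f x)).1; [exact: ef0 | exists y].
have d'S : surj d'.
  move=> y; have /eE[z zE] : e (i y) = 0 by apply/iE; exists y.
  by exists z; apply: (injP iI); rewrite d'E zE.
have [l lE] := projective_lift f' PQ d'S.
by exists l => x; rewrite -d'E lE f'E.
Qed.

Lemma lift_pres P1 P0 M (d : rhom P1 P0) (e : rhom P0 M)
    Q1 Q0 N (d' : rhom Q1 Q0) (e' : rhom Q0 N) (f : rhom M N) :
  presentation d e -> presentation d' e' -> exists (s0 : rhom P0 Q0) (s1 : rhom P1 Q1),
    (forall x, e' (s0 x) = f (e x)) /\ (forall x, d' (s1 x) = s0 (d x)).
Proof.
move=> H H'; have [PP1 PP0 eS eE] := H; have [PQ1 PQ0 e'S e'E] := H'.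
have [s0 s0E] := projective_lift (hcomp f e) PP0 e'S.
have [|s1 s1E] := lift_ker (f := hcomp s0 d) H' PP1.
  move=> x; rewrite homE s0E homE; have -> : e (d x) = 0 by apply/eE; exists x.
  by rewrite linear0.
by exists s0, s1; split=> x; rewrite ?s0E ?s1E homE.
Qed.

Lemma minpres_retract P1 P0 M (d : rhom P1 P0) (e : rhom P0 M)
    Q1 Q0 N (d' : rhom Q1 Q0) (e' : rhom Q0 N) (i : rhom N M) (p : rhom M N) :
  presentation d e -> minpres d' e' -> retract i p ->
  exists (s0 : rhom Q0 P0) (s1 : rhom Q1 P1) (r0 : rhom P0 Q0) (r1 : rhom P1 Q1),
    [/\ forall x, d (s1 x) = s0 (d' x), forall x, d' (r1 x) = r0 (d x),
        forall x, e' (r0 x) = p (e x), retract s0 r0 & retract s1 r1].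
Proof.
move=> H [H' e's d's] pi; have [PQ1 PQ0 e'S e'E] := H'.
have [s0 [s1 [s0E s1E]]] := lift_pres i H' H.
have [r0 [r1 [r0E r1E]]] := lift_pres p H H'.
have a0I : inj (hcomp r0 s0).
  by apply: superfluousP e's _ => x; exists x; rewrite homE r0E s0E pi.
have [w0 w0E] := inv_exists a0I (inj_endo_surj a0I).
have ew0 x : e' (w0 x) = e' x.
  have [_ w0E'] := w0E; rewrite -[in RHS](w0E' x) homE r0E s0E pi //.
have a1d x : d' (hcomp r1 s1 x) = r0 (s0 (d' x)) by rewrite homE r1E s1E.
have a1I : inj (hcomp r1 s1).
  apply: superfluousP d's _ => y.
  have /e'E[z zE] : e' (w0 (d' y)) = 0 by rewrite ew0; apply/e'E; exists y.
  by exists z; rewrite a1d zE -(hcompE r0 s0) w0E.2.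
have [w1 w1E] := inv_exists a1I (inj_endo_surj a1I).
have w10 x : d' (w1 x) = w0 (d' x).
  by rewrite -[in RHS](w1E.2 x) a1d -(hcompE r0 s0) w0E.1.
exists s0, s1, (hcomp w0 r0), (hcomp w1 r1); split=> // x.
- by rewrite !homE w10 r1E.
- by rewrite homE ew0 r0E.
- by rewrite homE -(hcompE r0 s0) w0E.1.
- by rewrite homE -(hcompE r1 s1) w1E.1.
Qed.

Lemma extends_minpres P1 P0 M (d : rhom P1 P0) (e : rhom P0 M)
    Q1 Q0 N (d' : rhom Q1 Q0) (e' : rhom Q0 N) (i : rhom N M) (p : rhom M N) X :
  presentation d e -> minpres d' e' -> retract i p -> extends d X -> extends d' X.
Proof.
move=> H H' pi dX h.
have [s0 [s1 [r0 [r1 [ds dr er rs0 rs1]]]]] := minpres_retract H H' pi.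
have [u uE] := dX (hcomp h r1); exists (hcomp u s0) => x.
by rewrite homE -ds uE homE rs1.
Qed.

(** Any presentation is the minimal one plus a split surjection [L -> Q0'] of projectives, whose
    kernel is [Q]. As [d] vanishes on [Q], a map [Q -> X] that extends along [d] must be zero. *)
Lemma minpres_compare P1 P0 M (d : rhom P1 P0) (e : rhom P0 M)
    Q1 Q0 (d' : rhom Q1 Q0) (e' : rhom Q0 M) : presentation d e -> minpres d' e' ->
  exists Q, [/\ projective Q,
    forall X, (hdim P0 X + hdim Q1 X + hdim Q X = hdim Q0 X + hdim P1 X)%N &
    forall X, extends d X -> forall (h : rhom Q X) x, h x = 0].
Proof.
move=> H H'; have [|s0 [s1 [r0 [r1 [ds dr er rs0 rs1]]]]] :=
    minpres_retract (i := hid M) (p := hid M) H H'.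
  by move=> x; rewrite !homE.
have [PP1 PP0 eS eE] := H; have [[PQ1 PQ0 e'S e'E] e's d's] := H'.
have [L [i2 [p2 HL]]] := retract_sum2 rs1; have [Q0' [j2 [q2 HQ]]] := retract_sum2 rs0.
have SL : is_sum2 Q1 L P1 by exists s1, i2, r1, p2.
have SQ : is_sum2 Q0 Q0' P0 by exists s0, j2, r0, q2.
case: HL => _ p2i2 p2s1 r1i2 e1; case: HQ => _ q2j2 q2s0 r0j2 e0.
have PL : projective L by exact: projective_retract p2i2 PP1.
have PQ' : projective Q0' by exact: projective_retract q2j2 PP0.
pose g := hcomp q2 (hcomp d i2).
have gE x : j2 (g x) = d (i2 x).
  by rewrite /g !homE -[RHS]e0 -dr r1i2 !linear0 add0r.
have gS : surj g.
  move=> y; have /eE[x xE] : e (j2 y) = 0 by rewrite -[LHS]hidE -er r0j2 linear0.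
  have d'r1 : d' (r1 x) = 0 by rewrite dr xE r0j2.
  pose x' := x - s1 (r1 x).
  have dx' : d x' = j2 y by rewrite linearB /= ds d'r1 linear0 subr0.
  have r1x' : r1 x' = 0 by rewrite linearB /= rs1 subrr.
  exists (p2 x'); rewrite -[LHS]q2j2 gE -[RHS]q2j2 -dx'.
  by rewrite -[in RHS](e1 x') r1x' linear0 add0r.
have [s sE] := projective_lift (hid Q0') PQ' gS.
have [|Q [i3 [p3 HQ3]]] := @retract_sum2 K A _ _ s g; first by move=> x; rewrite sE homE.
have S3 : is_sum2 Q0' Q L by exists s, i3, g, p3.
case: HQ3 => _ p3i3 p3s gi3 e3.
exists Q; split=> [|X|X dX h x]; first exact: projective_retract p3i3 PL.
  by rewrite (hdim_sum2l X SQ) (hdim_sum2l X SL) (hdim_sum2l X S3); lia.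
have [u uE] := dX (hcomp h (hcomp p3 p2)).
by have := uE (i2 (i3 x)); rewrite -gE gi3 !linear0 !homE p2i2 p3i3.
Qed.

End Projectives.

(** * The Auslander-Reiten translation *)

Section Tau.
Variables (K : fieldType) (A : falgType K).
Implicit Types M N P Q X Y Z R : rmod A.

Definition dual_elt P (h : rhom P (regular_rmod A)) : proj_dual P :=
  vsproj (homs P (regular_rmod A)) (hom_val h).

Lemma dual_eltE P (h : rhom P (regular_rmod A)) : vsval (dual_elt h) = hom_val h.
Proof. by rewrite vsprojK //; apply/homsP; exists h. Qed.

Lemma dual_eltP P (h : proj_dual P) : exists k, h = dual_elt k.
Proof.
have /homsP[k kE] := subvsP h; exists k; apply: val_inj.
by rewrite /= dual_eltE kE.
Qed.

Lemma nu_map_hom (P Q : rmod A) (d : 'Hom(P, Q)) : rmod_hom d -> rmod_hom (nu_map d).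
Proof.
move=> dH a phi; rewrite !nu_mapE; apply/lfunP => h.
rewrite comp_lfunE [LHS]nu_ractE [RHS]nu_ractE comp_lfunE; congr (_ _).
by apply/val_inj/lfunP => x; rewrite /= proj_dual_lactE !proj_dual_mapE // proj_dual_lactE.
Qed.

(* A homomorphism [g : M -> nu P] induces the functional [x h |-> g x h] on
   [Hom(P, M)], where [x h] is the map [y |-> x (h y)]; this says that it is well defined. *)
Lemma nu_pairing P M (g : rhom M (nu P)) q (x : M) (k : rhom P (regular_rmod A))
    (xs : 'I_q -> M) (ks : 'I_q -> rhom P (regular_rmod A)) : projective P ->
  (forall y, ract M (k y) x = \sum_j ract M (ks j y) (xs j)) ->
  (g x : 'Hom(proj_dual P, K^o)) (dual_elt k) =
  \sum_j (g (xs j) : 'Hom(proj_dual P, K^o)) (dual_elt (ks j)).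
Proof.
move=> PP E; have [r [p [h ph]]] := dual_basis PP.
(* By the dual basis, [l] is the sum of the coordinate forms [h i] multiplied by the values
   [l (p i)]. Moving these values across [g] reduces both sides to the elements that the hypothesis
   compares. *)
have expand (l : rhom P (regular_rmod A)) z :
    (g z : 'Hom(proj_dual P, K^o)) (dual_elt l) =
    \sum_i (g (ract M (l (p i)) z) : 'Hom(proj_dual P, K^o)) (dual_elt (h i)).
  have -> : dual_elt l = \sum_i proj_dual_lact P (l (p i)) (dual_elt (h i)).
    apply/val_inj/lfunP => y; rewrite linear_sum /= sum_lfunE dual_eltE {1}(ph y) linear_sum.
    apply: eq_bigr => i _; rewrite proj_dual_lactE [LHS](hom_ract l) ract_regular.
    by rewrite dual_eltE.
  rewrite linear_sum; apply: eq_bigr => i _.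
  by rewrite hom_ract nu_ractE.
rewrite expand (eq_bigr _ (fun j _ => expand (ks j) (xs j))) exchange_big /=.
apply: eq_bigr => i _; rewrite E linear_sum sum_lfunE.
by apply: eq_bigr.
Qed.

(** A map into tau M becomes a map [g'] into [nu P1] whose functionals vanish on all forms that
    factor through [d]. For [x] in M and a form [k] on P1, the map y |-> x k(y) extends along [d] to
    some [u]; a dual basis of P0 then expresses it through forms factoring through [d], so
    [nu_pairing] gives zero. *)
Lemma tau_hom0 P1 P0 M (d : rhom P1 P0) (e : rhom P0 M) : minpres d e -> extends d M ->
  exists2 T, is_tau M T & homs M T = 0%VS.
Proof.
move=> [[PP1 PP0 eS eE] es ds] dM.
have [T [j [jI jE]]] := ker_exists (RHom (nu_map_hom (homP d))).
exists T.
  exists P1, P0, d, e; split.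
    split=> //; first by split; exact: homP.
    - exact/surj_limg.
    - apply/vspaceP => x; apply/idP/idP => [/mem_limg xd|].
        by rewrite memv_ker; apply/eqP/eE.
      by rewrite memv_ker => /eqP/eE xd; apply/mem_limg.
  exists j; split; [exact: homP | exact/inj_lker |].
  apply/vspaceP => x; apply/idP/idP => [/mem_limg/jE|]; first by rewrite memv_ker => /= ->.
  by rewrite memv_ker => /eqP/jE xj; apply/mem_limg.
apply/eqP; rewrite -dimv_eq0; apply/eqP/hdim0 => g x; apply: jI.
pose g' := hcomp j g.
have g'0 z (h : rhom P0 (regular_rmod A)) :
    (g' z : 'Hom(proj_dual P1, K^o)) (dual_elt (hcomp h d)) = 0.
  have /= : nu_map d (g' z) = 0 by apply/jE; exists (g z); rewrite homE.
  rewrite nu_mapE => /lfunP/(_ (dual_elt h)); rewrite zero_lfunE.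
  suff -> : dual_elt (hcomp h d) = proj_dual_map d (dual_elt h).
    by move=> H; exact: etrans (esym (comp_lfunE _ _ _)) H.
  apply/val_inj/lfunP => y; rewrite [LHS]/= [RHS]/=.
  by rewrite (proj_dual_mapE _ _ (homP d)) !dual_eltE comp_lfunE.
apply/lfunP => h; have [k {h}->] := dual_eltP h; rewrite zero_lfunE.
have [ev evE] := eval_hom x.
have [u uE] := dM (hcomp ev k).
have [q [p [h ph]]] := dual_basis PP0.
rewrite -(hcompE j g).
rewrite (@nu_pairing P1 M g' q x k (fun i => u (p i)) (fun i => hcomp (h i) d) PP1).
  by rewrite big1 // => i _; exact: g'0.
move=> y; rewrite -evE -(hcompE ev k) -uE {1}(ph (d y)) linear_sum.
by apply: eq_bigr => i _; rewrite [LHS](hom_ract u) hcompE.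
Qed.

Lemma pres_sum2 P1 P0 M (d : rhom P1 P0) (e : rhom P0 M)
    Q1 Q0 N (d' : rhom Q1 Q0) (e' : rhom Q0 N) S : presentation d e -> presentation d' e' ->
  is_sum2 M N S -> exists R1 R0 (b : rhom R1 R0) (c : rhom R0 S),
    [/\ presentation b c, is_sum2 P1 Q1 R1, is_sum2 P0 Q0 R0 &
      forall X, extends d X -> extends d' X -> extends b X].
Proof.
move=> [PP1 PP0 eS eE] [PQ1 PQ0 e'S e'E] [i1 [i2 [p1 [p2 [e11 e22 e12 e21 es]]]]].
have [R1 [a1 [a2 [b1 [b2 [f11 f22 f12 f21 fs]]]]]] := sum2_exists P1 Q1.
have [R0 [m1 [m2 [n1 [n2 [g11 g22 g12 g21 gs]]]]]] := sum2_exists P0 Q0.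
have S1 : is_sum2 P1 Q1 R1 by exists a1, a2, b1, b2.
have S0 : is_sum2 P0 Q0 R0 by exists m1, m2, n1, n2.
pose b := hadd (hcomp m1 (hcomp d b1)) (hcomp m2 (hcomp d' b2)).
pose c := hadd (hcomp i1 (hcomp e n1)) (hcomp i2 (hcomp e' n2)).
have bE x : b x = m1 (d (b1 x)) + m2 (d' (b2 x)) by rewrite !homE.
have cE x : c x = i1 (e (n1 x)) + i2 (e' (n2 x)) by rewrite !homE.
exists R1, R0, b, c; split=> // [|X dX d'X h].
  split; [exact: projective_sum2 S1 _ _ | exact: projective_sum2 S0 _ _ | |].
  - move=> y; have [x1 x1E] := eS (p1 y); have [x2 x2E] := e'S (p2 y).
    exists (m1 x1 + m2 x2); rewrite cE !linearD /= g11 g22 g12 g21 !linear0 addr0 add0r.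
    by rewrite x1E x2E.
  - move=> x; split=> [c0|[y <-]].
      have /eE[y1 y1E] : e (n1 x) = 0.
        by rewrite -(e11 (e _)) -[i1 _](addrK (i2 (e' (n2 x)))) -cE c0 sub0r linearN /= e21 oppr0.
      have /e'E[y2 y2E] : e' (n2 x) = 0.
        rewrite -(e22 (e' _)) -[i2 _](addKr (i1 (e (n1 x)))) -cE c0 addr0 linearN /= e12 oppr0 //.
      exists (a1 y1 + a2 y2); rewrite bE !linearD /= f11 f22 f12 f21 !linear0 addr0 add0r.
      by rewrite y1E y2E gs.
    rewrite cE bE !linearD /= g11 g22 g12 g21 !linear0 addr0 add0r.
    have -> : e (d (b1 y)) = 0 by apply/eE; exists (b1 y).
    have -> : e' (d' (b2 y)) = 0 by apply/e'E; exists (b2 y).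
    by rewrite !linear0 addr0.
have [u1 u1E] := dX (hcomp h a1); have [u2 u2E] := d'X (hcomp h a2).
exists (hadd (hcomp u1 n1) (hcomp u2 n2)) => x.
rewrite haddE (hcompE u1) (hcompE u2) bE !linearD /= g11 g22 g12 g21 !linear0 addr0 add0r.
by rewrite u1E u2E !homE -linearD fs.
Qed.

Lemma pres_zero Z : zero_rmod Z -> presentation (hid Z) (hid Z).
Proof.
move=> Z0; split=> [|||x]; try exact: projective_zero.
  by move=> x; exists x; rewrite homE.
by split=> _; [exists x; rewrite homE | rewrite homE; exact: (zero_rmodP Z).1 Z0 x].
Qed.

Lemma extends_zero Z X : zero_rmod Z -> extends (hid Z) X.
Proof. by move=> _ h; exists h => x; rewrite homE. Qed.

Lemma rigid_on_add_hull T M : add_hull (rigid_on T) M -> rigid_on T M.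
Proof.
elim=> [Z Z0|X N {}M [P1 [P0 [d [e [de dT]]]]] S _ [Q1 [Q0 [d' [e' [de' dT']]]]]].
  by exists Z, Z, (hid Z), (hid Z); split; [exact: pres_zero | move=> X _; exact: extends_zero].
have [R1 [R0 [b [c [bc _ _ bX]]]]] := pres_sum2 de de' S.
by exists R1, R0, b, c; split=> // Y TY; apply: bX; [exact: dT | exact: dT'].
Qed.

Lemma rigid_on_retract T M N (i : rhom N M) (p : rhom M N) : retract i p ->
  rigid_on T M -> exists P1 P0 (d : rhom P1 P0) (e : rhom P0 N),
    minpres d e /\ forall X, T X -> extends d X.
Proof.
move=> pi [P1 [P0 [d [e [de dT]]]]].
have [Q1 [Q0 [d' [e' de']]]] := minpres_exists N.
exists Q1, Q0, d', e'; split=> // X TX.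
exact: extends_minpres de de' pi (dT _ TX).
Qed.

Lemma rigid_on_iso T M N : iso M N -> rigid_on T M -> rigid_on T N.
Proof.
move=> [f [fI fS]] HM; have [g [gf fg]] := inv_exists fI fS.
by have [P1 [P0 [d [e [[de _ _] dT]]]]] := rigid_on_retract fg HM; exists P1, P0, d, e.
Qed.

Lemma rigid_on_sub (T T' : rmod A -> Prop) M : (forall X, T' X -> T X) ->
  rigid_on T M -> rigid_on T' M.
Proof.
by move=> sub [P1 [P0 [d [e [de dT]]]]]; exists P1, P0, d, e; split=> // X /sub; exact: dT.
Qed.

(** This is vanishing of Ext^1(M, L) deduced from vanishing of Hom(L, tau M). A lift on P0 fails to
    descend to M by a map [k : P1 -> L]; extending [k] to P0 and subtracting repairs it. *)
Lemma rigid_lift M L Y Z (T : rmod A -> Prop) (i : rhom L Y) (g : rhom Y Z) (f : rhom M Z) :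
  rigid_on T M -> T L -> inj i -> (forall x, g x = 0 <-> exists y, i y = x) ->
  surj g -> exists l : rhom M Y, forall x, g (l x) = f x.
Proof.
move=> [P1 [P0 [d [e [[PP1 PP0 eS eE] dT]]]]] TL iI iE gS.
have [l lE] := projective_lift (hcomp f e) PP0 gS.
have ed x : e (d x) = 0 by apply/eE; exists x.
have [|k kE] := factor_inj (f := hcomp l d) iI.
  move=> x; rewrite homE; have [|y <-] := (iE (l (d x))).1; last by exists y.
  by rewrite lE homE ed linear0.
have [u uE] := dT _ TL k.
have [|m mE] := factor_surj (f := hadd l (hopp (hcomp i u))) eS.
  by move=> _ /eE[y <-]; rewrite !homE uE kE homE subrr.
exists m => x; have [y <-] := eS x; rewrite mE !homE linearB /= lE homE.
have -> : g (i (u y)) = 0 by apply/iE; exists (u y).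
by rewrite subr0.
Qed.

Lemma hdim_proj P N R M (i : rhom N R) (g : rhom R M) : projective P ->
  inj i -> surj g -> (forall x, g x = 0 <-> exists y, i y = x) ->
  hdim P R = (hdim P N + hdim P M)%N.
Proof.
move=> PP iI gS iE; apply: (hdim_post iI iE) => // f.
split=> [_|_]; first exact: projective_lift.
by apply/homsP; exists f.
Qed.

(* The defect is [dim Hom(X, tau M)] when d is a minimal presentation of M. *)
Lemma hdim_pres P1 P0 M (d : rhom P1 P0) (e : rhom P0 M) X : presentation d e ->
  exists2 c, (hdim P0 X + c = hdim M X + hdim P1 X)%N & extends d X <-> c = 0%N.
Proof.
move=> [PP1 PP0 eS eE].
have [|f1 f2 E [h hE]|b f1 f2 [h1 h1E] [h2 h2E]|S [S1 S2]] :=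
    @homs_of_pred K A P1 X (fun f => exists h : rhom P0 X, forall x, h (d x) = f x).
- by exists (hzero P0 X) => x; rewrite !homE.
- by exists h => x; rewrite -E.
- by exists (hadd (hscale b h1) h2) => x; rewrite !homE h1E h2E.
exists (hdim P1 X - \dim S)%N.
  rewrite (hdim_pre eS eE S1 S2) -addnA; congr addn.
  by rewrite subnKC // dimvS.
split=> [dX|/eqP].
  apply/eqP; rewrite subn_eq0; apply/dimvS/subvP => _ /homsP[h <-].
  exact/S2/dX.
rewrite subn_eq0 => le h; apply/S2.
have -> : S = homs P1 X by apply/eqP; rewrite eqEdim S1.
by apply/homsP; exists h.
Qed.

End Tau.

(** * Silting completions *)

Section Spans.
Variable T : Type.
Implicit Types f g : T -> rat.

(** Rational functions on all modules replace a Grothendieck group: a projective is represented by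
    the dimensions of its Hom spaces. *)
Definition spanned n (a : 'I_n -> T -> rat) f :=
  exists c : 'I_n -> rat, forall x, f x = \sum_i c i * a i x.

Definition fun_free n (a : 'I_n -> T -> rat) :=
  forall c : 'I_n -> rat, (forall x, \sum_i c i * a i x = 0) -> forall i, c i = 0.

Lemma spanned_eq n (a : 'I_n -> T -> rat) f g : (forall x, f x = g x) ->
  spanned a f -> spanned a g.
Proof. by move=> fg [c cE]; exists c => x; rewrite -fg. Qed.

Lemma spanned0 n (a : 'I_n -> T -> rat) : spanned a (fun=> 0).
Proof. by exists (fun=> 0) => x; rewrite big1 // => i _; rewrite mul0r. Qed.

Lemma spannedD n (a : 'I_n -> T -> rat) f g : spanned a f -> spanned a g ->
  spanned a (fun x => f x + g x).
Proof.
move=> [c cE] [b bE]; exists (fun i => c i + b i) => x; rewrite cE bE -big_split.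
by apply: eq_bigr => i _; rewrite mulrDl.
Qed.

Lemma spannedB n (a : 'I_n -> T -> rat) f g : spanned a f -> spanned a g ->
  spanned a (fun x => f x - g x).
Proof.
move=> [c cE] [b bE]; exists (fun i => c i - b i) => x; rewrite cE bE -sumrB.
by apply: eq_bigr => i _; rewrite mulrBl.
Qed.

Lemma spanned_mem n (a : 'I_n -> T -> rat) i : spanned a (a i).
Proof.
exists (fun j => (j == i)%:R) => x; rewrite (bigD1 i) //= eqxx mul1r big1 ?addr0 //.
by move=> j /negPf ->; rewrite mul0r.
Qed.

(** With n > m the coefficient matrix has a nonzero left kernel vector, which would be a relation
    among the [a i]. *)
Lemma free_leq n m (a : 'I_n -> T -> rat) (b : 'I_m -> T -> rat) :
  fun_free a -> (forall i, spanned b (a i)) -> (n <= m)%N.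
Proof.
move=> aF ab; pose c i := projT1 (cid (ab i)).
have cE i x : a i x = \sum_j c i j * b j x by exact: (projT2 (cid (ab i))).
pose H : 'M[rat]_(n, m) := \matrix_(i, j) c i j.
rewrite leqNgt; apply/negP => mn.
have /rowV0Pn[v /sub_kermxP vH /eqP v0] : kermx H != 0.
  by rewrite -mxrank_eq0 mxrank_ker -lt0n subn_gt0 (leq_ltn_trans (rank_leq_col H)).
apply: v0; apply/rowP => i; rewrite [RHS]mxE; move: i; apply: aF => x.
under eq_bigr => i _ do rewrite cE mulr_sumr.
rewrite exchange_big /= big1 // => j _.
transitivity ((v *m H) 0 j * b j x); last by rewrite vH mxE mul0r.
by rewrite mxE mulr_suml; apply: eq_bigr => i _; rewrite mxE mulrA.
Qed.

End Spans.

Section Completion.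
Variables (K : fieldType) (A : falgType K).
Implicit Types M N P Q X Y Z R C : rmod A.

Record resolution := Resolution {
  res1 : rmod A; res0 : rmod A; resM : rmod A;
  resd : rhom res1 res0; rese : rhom res0 resM; resP : presentation resd rese }.

(** The g-vector of the resolution paired with the dimension vector of X. It depends on the chosen
    resolution, which need not be minimal. *)
Definition gvec (r : resolution) X : rat := (hdim (res0 r) X)%:R - (hdim (res1 r) X)%:R.

Definition hdimQ M X : rat := (hdim M X)%:R.

(* Tau-rigidity: [Hom(N, tau N) = 0] if and only if [Hom(-, tau N)] vanishes on Gen N. *)
Definition rigid N := rigid_on (Gen N) N.

Definition iso_in m (F : 'I_m -> rmod A) Y := exists j, iso Y (F j).

Lemma direct_sum_of_dsum k (F : 'I_k -> rmod A) M : dsum F M -> direct_sum_of F M.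
Proof.
move=> [i [p [pi pi0 ip]]]; exists (fun j => hom_val (i j)).
have iI j : inj (i j) by move=> x e; rewrite -(pi j x) e linear0.
split; first by move=> j; split; [exact: homP | exact/inj_lker].
  apply/directv_sum_independent => u uI u0 j _.
  have /mem_limg[x xE] := uI j isT.
  have : p j (\sum_l u l) = 0 by rewrite u0 linear0.
  rewrite linear_sum (bigD1 j) //= big1 => [|l lj]; last first.
    by have /mem_limg[y <-] := uI l isT; rewrite pi0.
  by rewrite addr0 -xE pi => ->; rewrite linear0.
apply/eqP; rewrite eqEsubv subvf; apply/subvP => x _; rewrite -(ip x).
by apply: memv_suml => j _; apply: (subvP (sumv_sup j _ _)) => //; apply/mem_limg; exists (p j x).
Qed.

Lemma direct_summandP X M : direct_summand X M <->
  exists (i : rhom X M) (p : rhom M X), retract i p.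
Proof.
split=> [[i [p [iH pH /lfunP e]]]|[i [p ip]]].
  by exists (RHom iH), (RHom pH) => x; have := e x; rewrite comp_lfunE id_lfunE.
exists i, p; split; [exact: homP | exact: homP |].
by apply/lfunP => x; rewrite comp_lfunE id_lfunE ip.
Qed.

Lemma num_indec_of_representatives k (F : 'I_k -> rmod A) M m (s : 'I_m -> 'I_k) :
  dsum F M -> (forall j, indecomposable (F j)) ->
  (forall j l, iso (F (s j)) (F (s l)) -> j = l) ->
  (forall i, exists j, iso (F i) (F (s j))) -> num_indec_summands M m.
Proof.
move=> Fd Fi sn sF; have [I [P [PI _ _]]] := Fd.
exists (fun j => F (s j)); split=> [j|j l /isoP|N Ni /direct_summandP[i [p ip]]].
- by split=> //; apply/direct_summandP; exists (I (s j)), (P (s j)) => x; exact: PI.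
- exact: sn.
- have [j Nj] := krull_schmidt ip Ni Fd Fi; have [l jl] := sF j.
  by exists l; apply/isoP; exact: iso_trans Nj jl.
Qed.

(** A precover for the one-element family N is a surjection onto X from a sum of copies of N,
    through which [f] lifts. *)
Lemma projective_hom_gen0 Q N X (f : rhom Q X) : projective Q ->
  (forall (h : rhom Q N) x, h x = 0) -> Gen N X -> forall x, f x = 0.
Proof.
move=> PQ QN GX.
have [||R [g [RA _ gF]]] := @precover K A 1 (fun=> N) X (fun _ _ => True) => //.
have gS : surj g.
  move=> x; elim: (GX x) => [|h y z _ [w <-]]; first by exists 0; rewrite linear0.
  by have [l lE] := gF ord0 h I; exists (l y + w); rewrite linearD /= lE.
have [l lE] := projective_lift f PQ gS.
suff QR (h : rhom Q R) x : h x = 0 by move=> x; rewrite -lE QR linear0.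
move: h x; elim: RA => [Z /zero_rmodP Z0 h x|Y R' {l lE g gF gS}R0 [_ ->]]; first exact: Z0.
move=> [i1 [i2 [p1 [p2 [_ _ _ _ es]]]]] _ IH h x.
by rewrite -(es (h x)) -(hcompE p1 h) -(hcompE p2 h) IH QN !linear0 addr0.
Qed.

Lemma add_hull_retract_dsum k (F : 'I_k -> rmod A) m (s : 'I_m -> 'I_k) M X (i : rhom X M) p :
  dsum F M -> (forall j, indecomposable (F j)) ->
  (forall i, exists j, iso (F i) (F (s j))) -> retract i p ->
  add_hull (iso_in (fun j => F (s j))) X.
Proof.
move=> Fd Fi sF ip; have [q [G [Gi Gd]]] := decomposition_exists X.
apply: (dsum_add_hull Gd) => j; have [I [P [PI _ _]]] := Gd.
have [|l jl] := krull_schmidt (i := hcomp i (I j)) (p := hcomp (P j) p) _ (Gi j) Fd Fi.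
  by move=> x; rewrite !homE ip PI.
by have [u lu] := sF l; exists u; exact: iso_trans jl lu.
Qed.

(** The components of [f] are a basis of Hom(Q, N), so maps to N factor through [f]. A map to X in
    Gen N is first lifted, by projectivity of Q, to a sum of copies of N. *)
Lemma left_approx Q N : projective Q -> exists k N' (f : rhom Q N'),
  dsum (fun _ : 'I_k => N) N' /\
  forall X (h : rhom Q X), Gen N X -> exists v : rhom N' X, forall x, v (f x) = h x.
Proof.
move=> PQ; pose b := vbasis (homs Q N).
have bH (j : 'I_(\dim (homs Q N))) : exists h : rhom Q N, hom_val h = b`_j.
  by apply/homsP/vbasis_mem/mem_nth; rewrite size_tuple.
pose B j := projT1 (cid (bH j)).
have BE j : hom_val (B j) = b`_j by exact: (projT2 (cid (bH j))).
have [N' Nd] := dsum_exists (fun _ : 'I_(\dim (homs Q N)) => N).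
have [I [P [PI PI0 IP]]] := Nd.
have [f fE] : exists f : rhom Q N', forall x, f x = \sum_j I j (B j x).
  exists (hsum (fun j => hcomp (I j) (B j))) => x; rewrite hsumE.
  by apply: eq_bigr => j _; rewrite homE.
have fN (h : rhom Q N) : exists v : rhom N' N, forall x, v (f x) = h x.
  have hH : hom_val h \in homs Q N by apply/homsP; exists h.
  exists (hsum (fun j => hscale (coord b j (hom_val h)) (P j))) => x.
  rewrite hsumE [in RHS](coord_vbasis hH) sum_lfunE; apply: eq_bigr => j _.
  rewrite hscaleE scale_lfunE -BE; congr (_ *: _).
  by rewrite fE linear_sum (bigD1 j) //= PI big1 ?addr0 // => l lj; rewrite PI0.
exists (\dim (homs Q N)), N', f; split=> // X h GX.
have [||R [g [RA _ gF]]] := @precover K A 1 (fun=> N) X (fun _ _ => True) => //.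
have gS : surj g.
  move=> x; elim: (GX x) => [|l y z _ [w <-]]; first by exists 0; rewrite linear0.
  by have [l' lE] := gF ord0 l Logic.I; exists (l' y + w); rewrite linearD /= lE.
have [l lE] := projective_lift h PQ gS.
suff [v vE] : exists v : rhom N' R, forall x, v (f x) = l x.
  by exists (hcomp g v) => x; rewrite homE vE lE.
move: l {lE}; elim: RA => [Z /zero_rmodP Z0 l|Y R' M [_ ->]].
  by exists (hzero N' Z) => x; rewrite homE [RHS]Z0.
move=> [i1 [i2 [p1 [p2 [_ _ _ _ es]]]]] _ IH l.
have [v1 v1E] := fN (hcomp p1 l); have [v2 v2E] := IH (hcomp p2 l).
exists (hadd (hcomp i1 v1) (hcomp i2 v2)) => x.
by rewrite haddE (hcompE i1) (hcompE i2) v1E v2E !hcompE es.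
Qed.

(* The resolution [c] is the cone of a left Gen N-approximation Q -> N', and [b] the
   presentation of N' it is built from. *)
Lemma cone_exists N Q : rigid N -> projective Q -> exists b c : resolution,
  [/\ exists k, dsum (fun _ : 'I_k => N) (resM b),
      forall X, Gen N X -> extends (resd b) X /\ extends (resd c) X,
      Gen N (resM c),
      forall X, extends (resd c) X -> forall (f : rhom Q X) y, in_trace N (f y) &
      forall X, hdimQ Q X = gvec b X - gvec c X].
Proof.
move=> Nr PQ; have [k [N' [f [N'd fF]]]] := left_approx N PQ.
have N'A := dsum_add_hull (p := fun Y => Y = N) N'd (fun=> erefl).
have [|Q1 [Q0 [d' [e' [H' d'T]]]]] := @rigid_on_add_hull K A (Gen N) N'.
  by apply: add_hull_sub N'A => _ ->.
have [PQ1 PQ0 e'S e'E] := H'.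
have [f0 f0E] := projective_lift f PQ e'S.
have [P1 [a1 [a2 [b1 [b2 HP]]]]] := sum2_exists Q1 Q.
have SP : is_sum2 Q1 Q P1 by exists a1, a2, b1, b2.
case: HP => e11 e22 e12 e21 es.
have [C [p [pS pE]]] := coker_exists f.
(* The cokernel C of [f] is presented by Q1 + Q -> Q0: relations of N' together with a lift [f0] of
   [f]. Hence its g-vector is that of N' minus the class of Q. *)
pose d := hadd (hcomp d' b1) (hcomp f0 b2); pose e := hcomp p e'.
have dE x : d x = d' (b1 x) + f0 (b2 x) by rewrite /d !homE.
have eE x : e x = p (e' x) by rewrite /e homE.
have e'd' x : e' (d' x) = 0 by apply/e'E; exists x.
have de : presentation d e.
  split=> // [|y|x]; first exact: projective_sum2 SP PQ1 PQ.
    by have [z <-] := pS y; have [x <-] := e'S z; exists x.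
  rewrite eE pE; split=> [[q qE]|[y <-]].
    have /e'E[y yE] : e' (x - f0 q) = 0 by rewrite linearB /= f0E qE subrr.
    exists (a1 y + a2 q); rewrite dE !linearD /= e11 e22 e12 e21 !linear0 addr0 add0r.
    by rewrite yE subrK.
  by exists (b2 y); rewrite dE linearD /= e'd' add0r f0E.
exists (Resolution H'), (Resolution de); split=> //=.
- by exists k.
- move=> X GX; split=> [|h]; first exact: d'T.
  have [u uE] := d'T X GX (hcomp h a1).
  have [v vE] := fF X (hadd (hcomp h a2) (hopp (hcomp u f0))) GX.
  exists (hadd u (hcomp v e')) => x.
  rewrite haddE (hcompE v) dE !linearD /= e'd' linear0 add0r f0E vE uE !homE.
  by rewrite addrACA subrr addr0 -linearD es.
- apply: gen_surj pS _; apply: gen_add_hull; apply: add_hull_sub N'A => _ ->; exact: gen_refl.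
(* Extend [h], taken as zero on Q1, along [d]. The extension kills the relations of N', so it
   factors through N', and [h] through [f]. *)
- move=> X dX h y; have [u uE] := dX (hcomp h b2).
  have [|v vE] := factor_surj (f := u) e'S.
    move=> _ /e'E[z <-]; have := uE (a1 z).
    by rewrite dE e11 e12 linear0 addr0 => ->; rewrite homE e12 linear0.
  have -> : h y = v (f y).
    by rewrite -f0E vE; have := uE (a2 y); rewrite dE e22 e21 linear0 add0r homE e22.
  apply: in_trace_hom; apply: gen_add_hull; apply: add_hull_sub N'A => _ ->; exact: gen_refl.
- move=> X; rewrite /gvec /hdimQ /= (hdim_sum2l X SP) natrD; ring.
Qed.

End Completion.

(** * Counting the summands of a completion *)

Section Count.
Variables (K : fieldType) (A : falgType K).
Implicit Types M N P Q X Y Z R C : rmod A.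

Lemma spanned_like m (F : 'I_m -> rmod A) n (b : 'I_n -> rmod A -> rat) Q :
  (forall j, spanned b (hdimQ (F j))) -> add_hull (iso_in F) Q -> spanned b (hdimQ Q).
Proof.
move=> bF; elim=> [Z /zero_rmodP Z0|X N M [j Xj] S _ bN].
  apply: spanned_eq (spanned0 b) => X; apply/esym; rewrite /hdimQ.
  suff -> : hdim Z X = 0%N by [].
  by apply/hdim0 => f x; rewrite (Z0 x) linear0.
apply: spanned_eq (spannedD (bF j) bN) => Y.
by rewrite /hdimQ (hdim_sum2l Y S) natrD (hdim_isol Y Xj).
Qed.

Lemma gvec_gen T (r : resolution A) X : (forall X, T X -> extends (resd r) X) ->
  T X -> gvec r X = hdimQ (resM r) X.
Proof.
move=> rT TX; have [c cE [/(_ (rT X TX)) c0 _]] := hdim_pres X (resP r).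
apply/eqP; rewrite /gvec /hdimQ subr_eq -natrD eqr_nat; apply/eqP.
by rewrite -cE c0 addn0.
Qed.

Lemma resolution_iso M N P1 P0 (d : rhom P1 P0) (e : rhom P0 M) : iso M N -> presentation d e ->
  exists e' : rhom P0 N, presentation d e'.
Proof.
move=> [f [fI fS]] [PP1 PP0 eS eE]; exists (hcomp f e); split=> // [y|x].
  by have [z <-] := fS y; have [x <-] := eS z; exists x; rewrite homE.
by rewrite homE -eE; split=> [/fI|->]; rewrite ?linear0.
Qed.

Lemma hom_dim_free m (F : 'I_m -> rmod A) : (forall j, indecomposable (F j)) ->
  pairwise_non_iso F -> fun_free (fun j => hdimQ (F j)).
Proof.
move=> Fi Fn c cF j; have [N Nd] := dsum_exists F.
by apply: (hom_dim_independent Fi Fn Nd) => Y _; exact: cF.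
Qed.

(* F lists the summands of N and of the cones of the indecomposable projectives, and
   G the projectives killed by N.  The count is [m + p = |A|] because the g-vectors of
   F and G, and the indecomposable projectives, are bases of the same space of
   functions on modules. *)
Lemma completion N : rigid N -> exists m (F : 'I_m -> rmod A) p (G : 'I_p -> rmod A),
  [/\ [/\ forall j, indecomposable (F j), pairwise_non_iso F,
        forall j, Gen N (F j), forall j, rigid_on (Gen N) (F j) & add_hull (iso_in F) N],
    [/\ forall j, indecomposable (G j), pairwise_non_iso G, forall j, projective (G j) &
        forall j (h : rhom (G j) N) x, h x = 0],
    num_indec_summands (regular_rmod A) (m + p) &
    exists q (c : 'I_q -> resolution A),
      [/\ forall i, add_hull (iso_in F) (resM (c i)),
          forall i X, Gen N X -> extends (resd (c i)) X &
          forall X, (forall i, extends (resd (c i)) X) -> Gen N X]].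
Proof.
move=> Nr; have [k0 [E [Ei Ed]]] := decomposition_exists (regular_rmod A).
have [//|n [sE [_ En EE]]] := @representatives K A k0 E (fun=> True).
pose P i := E (sE i).
have PE i : exists j, iso (E i) (P j) by exact: EE.
have Pi i : indecomposable (P i) by exact: Ei.
have Pproj i : projective (P i).
  case: Ed => I [J [JI _ _]]; apply: (@projective_retract K A _ _ (I (sE i)) (J (sE i))).
    by move=> x; exact: JI.
  exact: projective_regular.
have Pn : pairwise_non_iso P by move=> i j /isoP; exact: En.
have projP_like Q : projective Q -> add_hull (iso_in P) Q.
  move=> PQ; have [k [D [Di Dd]]] := decomposition_exists Q.
  apply: (dsum_add_hull Dd) => j; have [I [J [JI _ _]]] := Dd.
  have [|l jl] := indec_projective Ed Ei (Di j) _.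
    by apply: (@projective_retract K A _ _ (I j) (J j)) => // x; exact: JI.
  by have [u lu] := PE l; exists u; exact: iso_trans jl lu.
have coneE i := cone_exists Nr (Pproj i).
pose b i := projT1 (cid (coneE i)).
have coneE' i : exists c : resolution A,
  [/\ exists k, dsum (fun _ : 'I_k => N) (resM (b i)),
      forall X, Gen N X -> extends (resd (b i)) X /\ extends (resd c) X,
      Gen N (resM c),
      forall X, extends (resd c) X -> forall (f : rhom (P i) X) y, in_trace N (f y) &
      forall X, hdimQ (P i) X = gvec (b i) X - gvec c X].
  exact: (projT2 (cid (coneE i))).
pose c i := projT1 (cid (coneE' i)).
have cP i : [/\ exists k, dsum (fun _ : 'I_k => N) (resM (b i)),
      forall X, Gen N X -> extends (resd (b i)) X /\ extends (resd (c i)) X,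
      Gen N (resM (c i)),
      forall X, extends (resd (c i)) X -> forall (f : rhom (P i) X) y, in_trace N (f y) &
      forall X, hdimQ (P i) X = gvec (b i) X - gvec (c i) X].
  exact: (projT2 (cid (coneE' i))).
have [C Cd] := dsum_exists (fun i => resM (c i)).
have [M [i1 [i2 [p1 [p2 HM]]]]] := sum2_exists N C.
have SM : is_sum2 N C M by exists i1, i2, p1, p2.
have GC : Gen N C by apply: gen_dsum Cd _ => i; case: (cP i).
have GM : Gen N M by exact: gen_sum2 SM (@gen_refl _ _ N) GC.
have Mr : rigid_on (Gen N) M.
  apply: rigid_on_add_hull; apply: add_hullS SM _ => //; apply: (dsum_add_hull Cd) => i.
  have [_ cx _ _ _] := cP i.
  exists (res1 (c i)), (res0 (c i)), (resd (c i)), (rese (c i)).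
  by split; [exact: resP | move=> X /cx[]].
have [k [D [Di Dd]]] := decomposition_exists M.
have [//|m [sD [_ Dn DD]]] := @representatives K A k D (fun=> True).
pose F j := D (sD j).
have DF i : exists j, iso (D i) (F j) by exact: DD.
have [e11 e22 _ _ _] := HM.
have NF : add_hull (iso_in F) N by exact: add_hull_retract_dsum Dd Di DF e11.
have [//|p [sG [G0 Gn GG]]] := @representatives K A n P (fun Y => forall (h : rhom Y N) x, h x = 0).
  move=> X Y [f [fI fS]] X0 h y; have [x <-] := fS y.
  by rewrite -(X0 (hcomp h f) x) homE.
pose G l := P (sG l).
have [I [J [JI _ _]]] := Cd; have [ID [JD [JDI _ _]]] := Dd.
have cF i : add_hull (iso_in F) (resM (c i)).
  apply: (@add_hull_retract_dsum _ _ _ D _ sD M _ (hcomp i2 (I i)) (hcomp (J i) p2)) => //.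
  by move=> x; rewrite !homE e22 JI.
have Fi j : indecomposable (F j) by exact: Di.
have Fn : pairwise_non_iso F by move=> i j /isoP; exact: Dn.
have FG j : Gen N (F j).
  by apply: (gen_surj (p := JD (sD j)) _ GM) => x; exists (ID (sD j) x); rewrite JDI.
have Fr j : exists r : resolution A, resM r = F j /\ forall X, Gen N X -> extends (resd r) X.
  have [|P1 [P0 [d [e [[de _ _] dX]]]]] :=
    @rigid_on_retract K A (Gen N) M (F j) (ID (sD j)) (JD (sD j)) _ Mr.
    by move=> x; exact: JDI.
  by exists (Resolution de).
pose r j := projT1 (cid (Fr j)).
have rM j : resM (r j) = F j by exact: (projT2 (cid (Fr j))).1.
have rX j X : Gen N X -> extends (resd (r j)) X by exact: (projT2 (cid (Fr j))).2.
have Frig j : rigid_on (Gen N) (F j).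
  rewrite -rM; exists (res1 (r j)), (res0 (r j)), (resd (r j)), (rese (r j)).
  by split; [exact: resP | exact: rX].
have Gi l : indecomposable (G l) by exact: Pi.
have Gnon : pairwise_non_iso G by move=> i j /isoP; exact: Gn.
pose a i := hdimQ (P i).
pose v (l : 'I_(m + p)) := match split l with inl j => gvec (r j) | inr l => hdimQ (G l) end.
have vl j : v (lshift p j) = gvec (r j).
  by rewrite /v -[lshift p j]/(unsplit (inl j)) unsplitK.
have vr l : v (rshift m l) = hdimQ (G l).
  by rewrite /v -[rshift m l]/(unsplit (inr l)) unsplitK.
(* On Gen N the [G l] have no maps and the g-vector of [F j] is dim Hom(F j, -), so independence on
   Gen N kills the coefficients of [F]. Those of [G] then vanish by independence on all modules. *)
have vfree : fun_free v.
  move=> w wv; have w0 X : \sum_j w (lshift p j) * v (lshift p j) X +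
      \sum_l w (rshift m l) * v (rshift m l) X = 0.
    by rewrite -[RHS](wv X) big_split_ord.
  have wl j : w (lshift p j) = 0.
    have [Fb Fbd] := dsum_exists F.
    apply: (@hom_dim_independent K A m F Fb (fun j => w (lshift p j)) Fi Fn Fbd) => Y GY.
    have GNY : Gen N Y by apply: gen_trans GY; exact: gen_dsum Fbd FG.
    rewrite -[RHS](w0 Y) [X in _ + X]big1 ?addr0 => [|l _].
      by apply: eq_bigr => i _; rewrite vl (gvec_gen (rX i) GNY) rM.
    rewrite vr /hdimQ; suff -> : hdim (G l) Y = 0%N by rewrite mulr0.
    by apply/hdim0 => f; apply: (projective_hom_gen0 _ (Pproj _) (G0 l) GNY).
  have wr l : w (rshift m l) = 0.
    refine (hom_dim_free Gi Gnon (c := fun l => w (rshift m l)) _ l) => Y; rewrite -[RHS](w0 Y).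
    rewrite [X in X + _]big1 ?add0r => [|i _]; last by rewrite wl mul0r.
    by apply: eq_bigr => i _; rewrite vr.
  move=> l; case: (split_ordP l) => [i|i] ->; [exact: wl | exact: wr].
have spanG Q : projective Q -> (forall X, Gen N X -> forall (h : rhom Q X) x, h x = 0) ->
    spanned v (hdimQ Q).
  move=> PQ Q0; apply: (@spanned_like _ G); first by move=> l; rewrite -vr; exact: spanned_mem.
  have [q [D' [Di' Dd']]] := decomposition_exists Q.
  apply: (dsum_add_hull Dd') => j; have [I' [J' [JI' _ _]]] := Dd'.
  have [|l jl] := indec_projective Ed Ei (Di' j) _.
    by apply: (@projective_retract K A _ _ (I' j) (J' j)) => // x; exact: JI'.
  have [u lu] := PE l; have [f [fI fS]] := iso_trans jl lu.
  have [|t ut] := GG u.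
    move=> h x; have [y <-] := fS x.
    by rewrite -(JI' j y) -(hcompE h f) -(hcompE _ (J' j)) (Q0 N) //; exact: gen_refl.
  by exists t; apply: iso_trans ut; exists f.
(* A second resolution [t] of the same module is built from the [r j], so its g-vector lies in the
   span. Both resolutions differ from a common minimal presentation by projectives without maps to
   Gen N, which [spanG] covers. *)
have spanF s : add_hull (iso_in F) (resM s) -> (forall X, Gen N X -> extends (resd s) X) ->
    spanned v (gvec s).
  move=> sF sX.
  have [t [tM tX tv]] : exists t, [/\ resM t = resM s,
      forall X, Gen N X -> extends (resd t) X & spanned v (gvec t)].
    elim: sF {sX} => [Z Z0|X L T [j Xj] S _ [t [tM tX tv]]].
      exists (Resolution (pres_zero Z0)); split=> //= [X _|]; first exact: extends_zero.
      by apply: spanned_eq (spanned0 v) => X; rewrite /gvec /= subrr.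
    have [f rf] : exists f : rhom (res0 (r j)) X, presentation (resd (r j)) f.
      by apply: (resolution_iso (M := resM (r j)) _ (resP (r j))); rewrite rM; exact: iso_sym.
    case: t tM tX tv => T1 T0 TM td te tP /= tM tX tv; subst TM.
    have [R1 [R0 [u [w [uw S1 S0 uX]]]]] := pres_sum2 rf tP S.
    exists (Resolution uw); split=> //= [Y GY|]; first by apply: uX; [exact: rX | exact: tX].
    apply: spanned_eq (spannedD (spanned_mem v (lshift p j)) tv) => Y.
    by rewrite vl /gvec /= (hdim_sum2l Y S1) (hdim_sum2l Y S0) !natrD; ring.
  case: t tM tX tv => T1 T0 TM td te tP /= tM tX tv; subst TM.
  have [M1 [M0 [d [e de]]]] := minpres_exists (resM s).
  have [Q [PQ QE Q0]] := minpres_compare (resP s) de.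
  have [Q' [PQ' QE' Q0']] := minpres_compare tP de.
  have sQ := spanG Q PQ (fun X GX => Q0 X (sX X GX)).
  have sQ' := spanG Q' PQ' (fun X GX => Q0' X (tX X GX)).
  apply: spanned_eq (spannedB (spannedD tv sQ') sQ) => X.
  have := QE X; have := QE' X; rewrite /gvec /hdimQ /=.
  move=> /(congr1 (fun z => z%:R : rat)) e1 /(congr1 (fun z => z%:R : rat)) e2.
  by rewrite !natrD in e1 e2; lra.
have bF i : add_hull (iso_in F) (resM (b i)).
  have [[q bd] _ _ _ _] := cP i.
  have [q' [D' [Di' Dd']]] := decomposition_exists (resM (b i)).
  apply: (dsum_add_hull Dd') => j; have [I' [J' [JI' _ _]]] := Dd'.
  have [_ [u [w uw]]] := indec_retract_dsum (JI' j) (Di' j) bd.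
  have [|l jl] := krull_schmidt (i := hcomp i1 u) (p := hcomp w p1) _ (Di' j) Dd Di.
    by move=> x; rewrite !homE e11 uw.
  by have [t lt] := DF l; exists t; exact: iso_trans jl lt.
(* The class of [P i] is the difference of the g-vectors in its approximation sequence, and both end
   terms have summands only among the [F j]. *)
have av i : spanned v (a i).
  have [_ cbX _ _ hE] := cP i.
  apply: spanned_eq (fun X => esym (hE X)) _; apply: spannedB; apply: spanF => //.
  - by move=> X /cbX[].
  - by move=> X /cbX[].
have aproj Q : projective Q -> spanned a (hdimQ Q).
  by move=> /projP_like; apply: spanned_like => i; exact: spanned_mem.
have va l : spanned a (v l).
  case: (split_ordP l) => [i|i] ->; rewrite ?vl ?vr; last exact/aproj/Pproj.
  by have [PR1 PR0 _ _] := resP (r i); apply: spannedB; exact: aproj.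
have afree : fun_free a by exact: hom_dim_free.
have nE : n = (m + p)%N.
  by apply/eqP; rewrite eqn_leq (free_leq afree av) (free_leq vfree va).
exists m, F, p, G; split=> //.
- by split=> // l; exact: Pproj.
- by rewrite -nE; exact: (num_indec_of_representatives Ed Ei En PE).
exists n, c; split=> // [i X GX|X cX]; first by have [_ cbX _ _ _] := cP i; have [] := cbX X GX.
(* The element [x] is the image of 1 under a map A -> X. Split A into the indecomposable
   projectives: by the cone property each of them maps into the trace of N. *)
move=> x; have [f fE] := eval_hom x; rewrite -(ractE1 x) -fE.
have [I0 [J0 [_ _ es]]] := Ed.
rewrite -(es (1 : A)) linear_sum; elim/big_ind: _ => [|y z|j _]; [exact: in_trace0 | exact: in_trace_add |].
have [i [g [gI gS]]] := PE j; have [h [hg gh]] := inv_exists gI gS.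
have [_ _ _ cH _] := cP i.
rewrite -(hg (J0 j 1)) /= -[f _](hcompE f (I0 j)) -(hcompE _ h).
exact: cH.
Qed.

(** Links classes Gen N to the finiteness hypothesis, which speaks of basic pairs only. *)
Lemma tau_tilting_of_rigid N : rigid N -> exists M P,
  [/\ tau_tilting_pair M P, basic_rmod M, basic_rmod P & forall X, Gen M X <-> Gen N X].
Proof.
move=> Nr; have [m [F [p [G [[Fi Fn FG Fr NF] [Gi Gn Gp G0] mp _]]]]] := completion Nr.
have [M Md] := dsum_exists F; have [P Pd] := dsum_exists G.
have GM : Gen N M by exact: gen_dsum Md FG.
have MN : Gen M N.
  apply: gen_add_hull; apply: add_hull_sub NF => X [j /iso_sym jX].
  by apply: gen_iso jX _; exact: gen_dsum_l Md.
have num k (E : 'I_k -> rmod A) L : (forall j, indecomposable (E j)) ->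
    pairwise_non_iso E -> dsum E L -> num_indec_summands L k.
  move=> Ei En Ld; apply: (@num_indec_of_representatives _ _ k E L k id Ld Ei) => // [j l jl|i].
    exact/En/isoP.
  by exists i; exact: iso_refl.
exists M, P; split.
- split.
  + by apply: projective_add_hull; exact: dsum_add_hull Pd Gp.
  + have Mr : rigid_on (Gen N) M by apply: rigid_on_add_hull; exact: dsum_add_hull Md Fr.
    have [|P1 [P0 [d [e [de dX]]]]] := @rigid_on_retract K A _ M M (hid M) (hid M) _ Mr.
      by move=> x; rewrite !homE.
    by apply: tau_hom0 de _; exact: dX.
  + apply/eqP; rewrite -dimv_eq0; apply/eqP/hdim0 => f x.
    have [I [J [_ _ es]]] := Pd; rewrite -(es x) linear_sum big1 // => j _.
    rewrite -[LHS](hcompE f (I j)); exact: (projective_hom_gen0 _ (Gp j) (G0 j) GM).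
  + by exists m, p; split=> //; [exact: num Md | exact: num Pd].
- by exists m, F; split=> //; exact: direct_sum_of_dsum.
- by exists p, G; split=> //; exact: direct_sum_of_dsum.
- by move=> X; split; apply: gen_trans.
Qed.

End Count.

(** * Descending to smaller torsion classes *)

Section Descent.
Variables (K : fieldType) (A : falgType K).
Implicit Types M N P Q X Y Z R L U B : rmod A.

Definition hom0 X Y := forall (h : rhom X Y) x, h x = 0.

Lemma indec_retract_add_hull (q : rmod A -> Prop) X M (i : rhom X M) p : indecomposable X ->
  add_hull q M -> retract i p -> exists Y (u : rhom X Y) v, q Y /\ retract u v.
Proof.
move=> Xi MA; elim: MA i p => [Z /zero_rmodP Z0|Y N {}M qY S _ IH] i p ip.
  case: Xi => /nonzero_rmodP[x xn0] _; case: xn0.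
  by rewrite -(ip x) (Z0 (i x)) linear0.
case: S => i1 [i2 [p1 [p2 [e11 e22 e12 e21 es]]]].
have [I1|I1] := pselect (inj (hcomp (hcomp p i1) (hcomp p1 i))).
  by have [w ww] := retract_of_inj I1; exists Y, (hcomp p1 i), (hcomp w (hcomp p i1)).
have [I2|I2] := pselect (inj (hcomp (hcomp p i2) (hcomp p2 i))).
  by have [w ww] := retract_of_inj I2; apply: IH ww.
exfalso; apply: (noninj_add Xi I1 I2) => x; by rewrite !homE -linearD /= es ip.
Qed.

Lemma add_hull_retract m (F : 'I_m -> rmod A) X M (i : rhom X M) p :
  (forall j, indecomposable (F j)) -> add_hull (iso_in F) M -> retract i p -> add_hull (iso_in F) X.
Proof.
move=> Fi MA ip; have [q [D [Di Dd]]] := decomposition_exists X.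
apply: (dsum_add_hull Dd) => j; have [I [J [JI _ _]]] := Dd.
have [|Y [u [v [[l Yl] uv]]]] := indec_retract_add_hull (i := hcomp i (I j)) (p := hcomp (J j) p) (Di j) MA.
  by move=> x; rewrite !homE ip JI.
exists l; apply: (iso_trans _ Yl); apply: indec_retract_iso uv (Di j).1 _.
exact: indec_iso (iso_sym Yl) (Fi l).
Qed.

Lemma comp0_add_hull (q : rmod A -> Prop) X L W (g : rhom L W) : add_hull q X ->
  (forall Z, q Z -> forall (k : rhom Z L) y, g (k y) = 0) ->
  forall (k : rhom X L) y, g (k y) = 0.
Proof.
move=> XA H; elim: XA => [Z /zero_rmodP Z0 k y|Z N M qZ].
  by rewrite (Z0 y) !linear0.
move=> [i1 [i2 [p1 [p2 [_ _ _ _ es]]]]] _ IH k y.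
rewrite -(es y) !linearD /= -(hcompE k i1) -(hcompE k i2) IH addr0.
exact: H.
Qed.

Lemma hom0_add_hull (q : rmod A -> Prop) X Y : add_hull q X -> (forall Z, q Z -> hom0 Z Y) -> hom0 X Y.
Proof.
move=> XA H h x; rewrite -(hidE (h x)).
by apply: (comp0_add_hull (g := hid Y) XA) => Z qZ k y; rewrite hidE; exact: H.
Qed.

Lemma hom0_isol X Y Z : iso X Y -> hom0 Y Z -> hom0 X Z.
Proof.
move=> [f [fI fS]] H h x; have [g [gf fg]] := inv_exists fI fS.
by rewrite -(gf x) -(hcompE h g) H.
Qed.

Lemma hom0_gen N X Y : Gen N X -> hom0 N Y -> hom0 X Y.
Proof. by move=> GX NY h; apply: gen_hom0 GX _ => f y; rewrite -(hcompE h f) NY. Qed.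

Lemma gen_hom0_zero N X : Gen N X -> hom0 N X -> zero_rmod X.
Proof.
move=> GX NX; apply/zero_rmodP => x; rewrite -(hidE x).
exact: (hom0_gen GX NX).
Qed.

Lemma not_hom0 X Y : ~ hom0 X Y -> exists (h : rhom X Y) x, h x <> 0.
Proof. by move=> /existsNP[h /existsNP[x hx]]; exists h, x. Qed.

Lemma gen_like N m (F : 'I_m -> rmod A) R : (forall j, Gen N (F j)) ->
  add_hull (iso_in F) R -> Gen N R.
Proof.
move=> FG RA; apply: gen_add_hull; apply: add_hull_sub RA => X [j /iso_sym jX].
exact: gen_iso jX (FG j).
Qed.

(** The kernel L of an approximation by the [F j] is tested against the resolutions [c k]. Given P1
    -> L, extend it to [u : P0 -> R]; then [g u] induces a map from the cone to Y, which lifts to R.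
    Subtracting that lift moves [u] into L without changing it on P1. *)
Lemma gen_precover N m (F : 'I_m -> rmod A) q (c : 'I_q -> resolution A) Y :
  (forall j, Gen N (F j)) -> add_hull (iso_in F) N -> (forall i, add_hull (iso_in F) (resM (c i))) ->
  (forall i X, Gen N X -> extends (resd (c i)) X) ->
  (forall X, (forall i, extends (resd (c i)) X) -> Gen N X) -> Gen N Y ->
  exists R (g : rhom R Y) L (i : rhom L R),
  [/\ add_hull (iso_in F) R, surj g, Gen N L, inj i &
      forall x, g x = 0 <-> exists y, i y = x].
Proof.
move=> FG NF cF cX cN GY.
have [||R [g [RA _ gF]]] := @precover K A m F Y (fun _ _ => True) => //.
have RF : add_hull (iso_in F) R by apply: add_hull_sub RA => _ [j ->]; exists j; exact: iso_refl.
have lift X (h : rhom X Y) : add_hull (iso_in F) X -> exists l : rhom X R, forall x, g (l x) = h x.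
  move=> XA; elim: XA h => [Z /zero_rmodP Z0 h|X1 X2 X3 [j [f [fI fS]]]].
    by exists (hzero Z R) => x; rewrite (Z0 x) !linear0.
  move=> [i1 [i2 [p1 [p2 [_ _ _ _ es]]]]] _ IH h; have [f' [f'f ff']] := inv_exists fI fS.
  have [l1 l1E] := gF j (hcomp h (hcomp i1 f')) Logic.I.
  have [l2 l2E] := IH (hcomp h i2).
  exists (hadd (hcomp l1 (hcomp f p1)) (hcomp l2 p2)) => x.
  by rewrite !homE linearD /= l1E l2E !homE f'f -linearD es.
have [L [i [iI iE]]] := ker_exists g.
exists R, g, L, i; split=> //.
  move=> y; elim: (GY y) => [|h z y' _ [x <-]]; first by exists 0; rewrite linear0.
  by have [l lE] := lift N h NF; exists (l z + x); rewrite linearD /= lE.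
apply: cN => k h; have [PP1 PP0 eS eE] := resP (c k).
have [u uE] := cX k _ (gen_like FG RF) (hcomp i h).
have [|w wE] := factor_surj (f := hcomp g u) eS.
  move=> _ /eE[x <-]; rewrite homE uE homE.
  by apply/iE; exists (h x).
have [w' w'E] := lift _ w (cF k).
have [|v vE] := factor_inj (f := hadd u (hopp (hcomp w' (rese (c k))))) iI.
  move=> x; set y := _ x; have [|z <-] := (iE y).1; last by exists z.
  by rewrite /y !homE linearB /= w'E wE homE subrr.
exists v => x; apply: (injP iI); rewrite vE !homE uE homE.
have -> : rese (c k) (resd (c k) x) = 0 by apply/eE; exists x.
by rewrite linear0 subr0.
Qed.

(** The analogue of the brick labelling a cover of torsion classes: a nonzero endomorphism of such a
    [B] is onto, hence bijective. *)
Definition label N U B := [/\ Gen N B, ~ zero_rmod B, hom0 U B &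
  forall X (f : rhom X B), Gen N X -> (exists x, f x <> 0) -> surj f].

(** A nonzero submodule of [B0] in Gen N of least dimension works, since the image of a nonzero map
    to it from Gen N is another such submodule. *)
Lemma label_of_min N U B0 : Gen N B0 -> ~ zero_rmod B0 -> hom0 U B0 ->
  exists B, label N U B.
Proof.
move=> G0 Z0 U0.
pose P n := `[< exists B (i : rhom B B0), [/\ Gen N B, ~ zero_rmod B, inj i & n = dimM B] >].
have exP : exists n, P n.
  exists (dimM B0); apply/asboolP; exists B0, (hid B0); split=> // x.
  by rewrite homE.
case: (ex_minnP exP) => _ /asboolP[B [i [GB ZB iI ->]]] Bmin.
exists B; split=> //.
  by move=> h x; apply: iI; rewrite -(hcompE i h) U0.
move=> X f GX [x fx]; have [I [p [j [pS jI fE]]]] := im_factor f.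
have jS : surj j.
  apply: (inj_surj jI); apply: Bmin; apply/asboolP; exists I, (hcomp i j).
  split=> //; first exact: gen_surj pS GX.
    by apply/nonzero_rmodP; exists (p x) => px; apply: fx; rewrite fE px linear0.
  by move=> y; rewrite homE => /iI/jI.
by move=> y; have [z <-] := jS y; have [t <-] := pS z; exists t.
Qed.

(* Take a label B of maximal dimension.  If the kernel L of Y -> B had a proper trace T,
   a minimal submodule of Y / T in Gen N would be a larger label. *)
Lemma label_max N U B0 : rigid N -> Gen N U -> Gen N B0 -> ~ zero_rmod B0 -> hom0 U B0 ->
  exists2 B, label N U B &
    forall Y L (f : rhom Y B) (i : rhom L Y), Gen N Y -> surj f -> inj i ->
      (forall x, f x = 0 <-> exists y, i y = x) -> Gen N L.
Proof.
move=> Nr GU G0 Z0 U0.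
pose P n := `[< exists2 B, label N U B & n = dimM B >].
have exP : exists n, P n.
  by have [B lB] := label_of_min G0 Z0 U0; exists (dimM B); apply/asboolP; exists B.
(* Since N has a nonzero map to each label, and that map is onto, dim N bounds the dimension of
   labels. *)
have Ple n : P n -> (n <= dimM N)%N.
  move=> /asboolP[B [GB ZB _ Bs] ->].
  have /not_hom0[h [x hx]] : ~ hom0 N B by move=> /(gen_hom0_zero GB).
  by apply: (@surj_dim _ _ _ _ h); apply: Bs; [exact: gen_refl | exists x].
case: (ex_maxnP exP Ple) => _ /asboolP[B lB ->] Bmax; exists B => // Y L f i GY fS iI iE.
have [GB ZB UB Bs] := lB.
have [T [t [tI tE GT tF]]] := trace_exists N L.
have [Z [p [pS pE]]] := coker_exists (hcomp i t).
have fit x : f (i (t x)) = 0 by apply/iE; exists (t x).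
have [|g gE] := factor_surj (f := f) pS.
  by move=> _ /pE[y <-]; rewrite homE fit.
have GZ : Gen N Z by exact: gen_surj pS GY.
(* Such a map lands in L / T. Maps from N lift to Y because T lies in Gen N; the lifts land in L,
   hence in its trace T, and become zero in Z. *)
have gker X (h : rhom X Z) : Gen N X -> (forall x, g (h x) = 0) -> forall x, h x = 0.
  move=> GX gh; apply: gen_hom0 GX _ => k y.
  have itI : inj (hcomp i t) by move=> x; rewrite homE => /iI/tI.
  have [l lE] := rigid_lift (hcomp h k) Nr GT itI pE pS.
  have [|l' l'E] := factor_inj (f := l) iI.
    move=> x; have [|z <-] := (iE (l x)).1; last by exists z.
    by rewrite -gE lE homE gh.
  have [l'' l''E] := tF l'.
  rewrite -(hcompE h k) -lE; apply/pE; exists (l'' y).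
  by rewrite homE l''E l'E.
have gS : surj g by move=> b; have [y <-] := fS b; exists (p y).
have ZZ : ~ zero_rmod Z.
  move=> /zero_rmodP ZZ; case/nonzero_rmodP: ZB => b; have [z <-] := gS b.
  by rewrite (ZZ z) linear0.
pose Q n := `[< exists Z' (j : rhom Z' Z), [/\ Gen N Z', ~ zero_rmod Z', inj j & n = dimM Z'] >].
have exQ : exists n, Q n.
  exists (dimM Z); apply/asboolP; exists Z, (hid Z); split=> // x.
  by rewrite homE.
case: (ex_minnP exQ) => _ /asboolP[Z' [j [GZ' ZZ' jI ->]]] Zmin.
have lZ' : label N U Z'.
  split=> // [h x|X h GX [x hx]].
    apply: jI; rewrite -(hcompE j h); apply: (gker U) => // y.
    by rewrite -(hcompE g) UB.
  have [I [r [s [rS sI hE]]]] := im_factor h.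
  have sS : surj s.
    apply: (inj_surj sI); apply: Zmin; apply/asboolP; exists I, (hcomp j s).
    split=> //; first exact: gen_surj rS GX.
      by apply/nonzero_rmodP; exists (r x) => rx; apply: hx; rewrite hE rx linear0.
    by move=> y; rewrite homE => /jI/sI.
  by move=> y; have [z <-] := sS y; have [u <-] := rS z; exists u.
have gjS : surj (hcomp g j).
  apply: (Bs _ _ GZ' _); apply: contrapT => /forallNP gj0.
  case: ZZ'; apply/zero_rmodP => z; apply: jI; apply: (gker _ _ GZ') => z'.
  by have /contrapT := gj0 z'; rewrite homE.
have gjI : inj (hcomp g j).
  by apply: surj_inj gjS _; apply: Bmax; apply/asboolP; exists Z'.
have [w [wE wE']] := inv_exists gjI gjS.
(* Maximality made [Z' -> B] bijective, so [g] splits. Its kernel V is a quotient of Z, hence in Gen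
   N, and [gker] makes it zero; thus L = T. *)
have [|V [i2 [p2 [e11 e22 e12 e21 es]]]] := @retract_sum2 K A Z' Z j (hcomp w g).
  by move=> x; rewrite homE -(hcompE g j) wE.
have wI : inj w by move=> b wb; rewrite -(wE' b) wb linear0.
have i20 x : i2 x = 0.
  apply: gker x => [|x]; last by apply: wI; rewrite -(hcompE w g) e21.
  by apply: (gen_surj (p := p2) _ GZ) => y; exists (i2 y).
have gI : inj g.
  by move=> z gz; rewrite -(es z) i20 addr0 homE gz !linear0.
move=> x; apply/tE.
have /pE[y yE] : p (i x) = 0.
  by apply: gI; rewrite gE; apply/iE; exists x.
by exists y; apply: (injP iI); rewrite -yE homE.
Qed.

(** Excludes the nilpotent case of [indec_endo]: an endomorphism of an indecomposable that fixes a
    nonzero [f] under composition is injective. *)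
Lemma nilp_comp_nonzero X B (f : rhom X B) (h : rhom X X) : (exists x, f x <> 0) ->
  (forall x, f (h x) = f x) -> ~ nilp h.
Proof.
move=> [x fx] fh [n hn]; apply: fx.
rewrite -[RHS](linear0 f) -(hn x).
by elim: n {hn} => //= n IH; rewrite fh.
Qed.

(* N' drops the unique summand of the completion with a nonzero map to B; it
   generates exactly the modules Y in Gen N with Hom(Y, B) = 0. *)
Lemma descent N U B0 : rigid N -> Gen N U -> Gen N B0 -> ~ zero_rmod B0 -> hom0 U B0 ->
  exists N', [/\ rigid N', Gen N' U, Gen N N' & ~ Gen N' N].
Proof.
move=> Nr GU G0 Z0 U0.
have [B [GB ZB UB Bs] Bk] := label_max Nr GU G0 Z0 U0.
have [m [F [_ [_ [[Fi Fn FG Fr NF] _ _ [q [c [cF cX cN]]]]]]]] := completion Nr.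
have [i /not_hom0[f0 f0n]] : exists i, ~ hom0 (F i) B.
  apply: contrapT => /forallNP F0; apply: ZB; apply: gen_hom0_zero GB _.
  apply: hom0_add_hull NF _ => X [j Xj]; apply: hom0_isol Xj _.
  exact: contrapT (F0 j).
(* A nonzero [a] is onto with kernel in Gen N, and X is rigid against Gen N. *)
have lift X Y (b : rhom X B) (a : rhom Y B) : rigid_on (Gen N) X -> Gen N Y ->
    (exists y, a y <> 0) -> exists l : rhom X Y, forall x, a (l x) = b x.
  move=> Xr GY an; have aS := Bs Y a GY an; have [L [j [jI jE]]] := ker_exists a.
  exact: rigid_lift b Xr (Bk _ _ _ _ GY aS jI jE) jI jE aS.
(* Two summands with nonzero maps to B factor those maps through each other; the composite
   endomorphism is not nilpotent, so the summands are isomorphic. *)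
have uniq j : ~ hom0 (F j) B -> j = i.
  move=> /not_hom0[h hn].
  have [phi phiE] := lift _ _ f0 h (Fr i) (FG j) hn.
  have [psi psiE] := lift _ _ h f0 (Fr j) (FG i) f0n.
  have [/(nilp_comp_nonzero f0n)[] x|I] := indec_endo (hcomp psi phi) (Fi i).
    by rewrite homE psiE phiE.
  have [w ww] := retract_of_inj I.
  by apply/esym/Fn/isoP; apply: indec_retract_iso ww (Fi i).1 (Fi j).
have [Z ZZ] := zero_exists A.
pose F' j := if j == i then Z else F j.
have [N' Nd'] := dsum_exists F'.
have F'B j : hom0 (F' j) B.
  rewrite /F'; case: eqP => [_ h x|ji]; first by rewrite ((zero_rmodP Z).1 ZZ x) linear0.
  by apply: contrapT => /uniq.
have F'like : add_hull (iso_in F') N' by apply: (dsum_add_hull Nd') => j; exists j; exact: iso_refl.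
have N'B : hom0 N' B.
  by apply: hom0_add_hull F'like _ => X [j Xj]; apply: hom0_isol Xj _.
have GNN' : Gen N N'.
  by apply: gen_dsum Nd' _ => j; rewrite /F'; case: eqP => _ //; exact: gen_zero.
exists N'; split=> //; last first.
- by move=> GN'; apply: ZB; apply: gen_hom0_zero N'B; apply: gen_trans GN' GB.
(* The claim is shown for every Y in Gen N without maps to B. Among surjections R -> Y from sums of
   the [F j] with kernel in Gen N, one of least dimension is taken, so that no [F j] splits off R
   inside the kernel. *)
- have : Gen N U by []; move: UB; move: U {GU U0} => Y YB GY.
  pose P n := `[< exists R (g : rhom R Y) L (l : rhom L R),
    [/\ [/\ add_hull (iso_in F) R, surj g & n = dimM R], Gen N L, inj l &
        forall x, g x = 0 <-> exists y, l y = x] >].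
  have exP : exists n, P n.
    have [R [g [L [l [RA gS GL lI lE]]]]] := gen_precover FG NF cF cX cN GY.
    by exists (dimM R); apply/asboolP; exists R, g, L, l.
  case: (ex_minnP exP) => _ /asboolP[R [g [L [l [[RA gS ->] GL lI lE]]]]] Rmin.
  have Rr : rigid_on (Gen N) R.
    apply: rigid_on_add_hull; apply: add_hull_sub RA => X [j /iso_sym jX].
    exact: rigid_on_iso jX (Fr j).
  (* If [b] were nonzero on the kernel, some [a : F j -> R] with [g a = 0] would have [b a] nonzero.
     Then [b] lifts to [e : R -> F j] along [b a], and [e a] is invertible, so [F j] splits off
     inside the kernel. *)
  have bL (b : rhom R B) y : b (l y) = 0.
    rewrite -(hcompE b l); move: y; apply: (gen_hom0 GL); apply: comp0_add_hull NF _.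
    move=> X [j Xj] k y; apply: contrapT; rewrite hcompE => bly.
    have [f [fI fS]] := iso_sym Xj; have [f' [f'f ff']] := inv_exists fI fS.
    pose a := hcomp l (hcomp k f); have ga x : g (a x) = 0.
      by apply/lE; exists (k (f x)); rewrite !homE.
    have ba0 : exists x, hcomp b a x <> 0 by exists (f' y); rewrite !homE ff'.
    have [e eE] := lift _ _ b (hcomp b a) Rr (FG j) ba0.
    have [/(nilp_comp_nonzero ba0)[] x|I] := indec_endo (hcomp e a) (Fi j).
      by rewrite (hcompE e) eE; exact/esym/hcompE.
    have [w ww] := retract_of_inj I.
    have [R2 [i2 [p2 H2]]] := retract_sum2 ww; have [e11 e22 e12 e21 es] := H2.
    have g2S : surj (hcomp g i2).
      move=> z; have [r <-] := gS z; exists (p2 r).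
      by rewrite homE -[in RHS](es r) linearD /= ga add0r.
    have [L2 [l2 [l2I l2E]]] := ker_exists (hcomp g i2).
    have [|r rE] := factor_inj (f := hcomp p2 l) l2I.
      move=> x; rewrite homE; have [|z <-] := (l2E (p2 (l x))).1; last by exists z.
      have gl : g (l x) = 0 by apply/lE; exists x.
      by rewrite homE -[RHS]gl -[in RHS](es (l x)) linearD /= ga add0r.
    have rS : surj r.
      move=> z; have /lE[x xE] : g (i2 (l2 z)) = 0.
        by rewrite -(hcompE g); apply/l2E; exists z.
      by exists x; apply: (injP l2I); rewrite rE homE xE e22.
    have : (dimM R <= dimM R2)%N.
      apply: Rmin; apply/asboolP; exists R2, (hcomp g i2), L2, l2; split=> //.
        by split=> //; exact: add_hull_retract Fi RA e22.
      exact: gen_surj rS GL.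
    rewrite (@sum2_dim _ _ (F j) R2); last by exists a, i2, (hcomp w e), p2.
    rewrite -{2}[dimM R2]add0n leq_add2r leqn0 => /eqP/zero_dim.
    by case: (Fi j).
  (* A map to B vanishing on the kernel factors through Y, which has no maps to B. Hence R avoids
     the summand [F i] and lies in Gen N'. *)
  have R0 : hom0 R B.
    move=> b; have [|b' b'E] := factor_surj (f := b) gS.
      by move=> _ /lE[y <-].
    by move=> x; rewrite -b'E YB.
  apply: gen_surj gS _; move: R0.
  elim: {g Rmin lE lI bL L GL l Rr} RA => [W W0 _|X M' M [j Xj] S _ IH M0].
    exact: gen_zero.
  have [i1 [i2 [p1 [p2 [e11 e22 _ _ _]]]]] := S.
  apply: gen_sum2 S _ _; last first.
    by apply: IH => h x; rewrite -(e22 x) -(hcompE h p2) M0.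
  apply: gen_iso (iso_sym Xj) _.
  have <- : F' j = F j; last exact: gen_dsum_l Nd'.
  rewrite /F'; case: eqP => // e; subst j; case: f0n => x; case.
  have [u [uI uS]] := Xj; have [y <-] := uS x.
  by rewrite -(e11 y) -(hcompE f0 u) -(hcompE _ p1) M0.
- apply: (@rigid_on_sub _ _ (Gen N)); first by move=> X; exact: gen_trans.
  apply: rigid_on_add_hull; apply: (dsum_add_hull Nd') => j; rewrite /F'.
  case: eqP => _; last exact: Fr.
  by apply: rigid_on_add_hull; apply: add_hull0.
Qed.

End Descent.

(** * Stability and Newton polytopes *)

Section Chain.
Variables (K : fieldType) (A : falgType K).
Implicit Types M N P Q X Y Z R L U V B : rmod A.

Lemma rigid_regular : rigid (regular_rmod A).
Proof.
have [Z Z0] := zero_exists A.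
exists Z, (regular_rmod A), (hzero Z _), (hid _); split=> [|X _ h].
  split=> [||y|x]; [exact: projective_zero | exact: projective_regular | |].
    by exists y; rewrite homE.
  rewrite homE; split=> [->|[y <-]]; last by rewrite homE.
  by exists 0; rewrite linear0.
exists (hzero _ X) => x.
by rewrite ((zero_rmodP Z).1 Z0 x) !linear0.
Qed.

(** Induction on the number of listed pairs whose first module generates a class inside Gen N; each
    descent lowers it. *)
Lemma minimal_rigid U : tau_tilting_finite A -> exists N,
  [/\ rigid N, Gen N U & forall B, Gen N B -> hom0 U B -> zero_rmod B].
Proof.
move=> [k [F FP]].
pose below N := [pred i : 'I_k | `[< forall X, Gen (F i).1 X -> Gen N X >]].
suff main n N : (#|below N| < n)%N -> rigid N -> Gen N U -> exists N,
    [/\ rigid N, Gen N U & forall B, Gen N B -> hom0 U B -> zero_rmod B].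
  apply: (main #|below (regular_rmod A)|.+1 (regular_rmod A)) => //.
    exact: rigid_regular.
  exact: gen_regular.
elim: n N => // n IH N Nn Nr GU.
have [H|/existsNP[B /not_implyP[GB /not_implyP[UB ZB]]]] :=
  pselect (forall B, Gen N B -> hom0 U B -> zero_rmod B); first by exists N.
have [N' [N'r GU' GN GN']] := descent Nr GU GB ZB UB.
apply: (IH N') => //; rewrite -ltnS (leq_trans _ Nn) // ltnS; apply: proper_card.
have [M [P [MP Mb Pb GM]]] := tau_tilting_of_rigid Nr.
have [i [/isoP Mi _]] := FP M P MP Mb Pb.
apply/properP; split.
  apply/fintype.subsetP => j; rewrite !inE => H X /H.
  exact: gen_trans.
have GF : forall X, Gen (F i).1 X <-> Gen N X.
  move=> X; rewrite -GM; split; apply: gen_trans.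
    by apply: gen_iso Mi _; exact: gen_refl.
  by apply: gen_iso (iso_sym Mi) _; exact: gen_refl.
(* The listed pair that generates Gen N itself is counted for N but not for N'. *)
exists i; rewrite !inE; first by move=> X /GF.
apply/negP => /asboolP H; apply: GN'; apply: H; apply/GF; exact: gen_refl.
Qed.

Definition exact_additive (theta : rmod A -> rat) := forall X Y Q (i : rhom Y X) (p : rhom X Q),
  inj i -> surj p -> (forall x, p x = 0 <-> exists y, i y = x) ->
  theta X = theta Y + theta Q.

(** The function is the sum of the g-vectors of the cones [c i]. It is additive because Hom from a
    projective is exact. On Gen N each term is dim Hom(resM (c i), -), so nonnegative; on modules
    without maps from N it is minus a defect, so nonpositive. *)
Lemma gen_stability N : rigid N -> exists theta, exact_additive theta /\
  forall X, Gen N X <-> forall Q, quotient_of X Q -> 0 <= theta Q.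
Proof.
move=> Nr; have [m [F [_ [_ [[_ _ FG _ _] _ _ [q [c [cF cX cN]]]]]]]] := completion Nr.
exists (fun X => \sum_i gvec (c i) X); split=> [X Y Q i p iI pS pE|X].
  rewrite -big_split; apply: eq_bigr => j _ /=; rewrite /gvec.
  have [PP1 PP0 _ _] := resP (c j).
  by rewrite (hdim_proj PP1 iI pS pE) (hdim_proj PP0 iI pS pE) !natrD; ring.
split=> [GX Q [p pH pS]|H].
  apply: sumr_ge0 => j _.
  have GQ : Gen N Q by apply: gen_surj GX; first exact: (surj_limg (RHom pH)).2.
  by rewrite (gvec_gen (cX j) GQ) ler0n.
have [T [t [tI tE GT tF]]] := trace_exists N X.
have [Q [p [pS pE]]] := coker_exists t.
(* A map from N to X / T lifts to X because T lies in Gen N, and then lands in the trace T. *)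
have NQ : hom0 N Q.
  move=> h x; have [l lE] := rigid_lift h Nr GT tI pE pS.
  have [l' l'E] := tF l; rewrite -lE; apply/pE; exists (l' x).
  by rewrite l'E.
have gle j : gvec (c j) Q <= 0 /\ (gvec (c j) Q = 0 -> extends (resd (c j)) Q).
  have [d dE dX] := hdim_pres Q (resP (c j)).
  have M0 : hdim (resM (c j)) Q = 0%N.
    by apply/hdim0; apply: hom0_gen NQ; exact: gen_like FG (cF j).
  have -> : gvec (c j) Q = - d%:R.
    rewrite /gvec; move: dE; rewrite M0 add0n => <-; rewrite natrD; ring.
  split; first by rewrite oppr_le0 ler0n.
  by move=> /eqP; rewrite oppr_eq0 pnatr_eq0 => /eqP/dX.
(* Nonpositive terms with a nonnegative sum all vanish. Then every cone extends to Q, which puts Q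
   in Gen N and, with [NQ], makes it zero. *)
have s0 : \sum_j gvec (c j) Q = 0.
  apply/eqP; rewrite eq_le H; first by rewrite andbT sumr_le0 // => j _; case: (gle j).
  by exists p; [exact: homP | exact/surj_limg].
have GQ : Gen N Q.
  apply: cN => j; have [_] := gle j; apply.
  have := @psumr_eq0P _ _ xpredT (fun j => - gvec (c j) Q).
  rewrite sumrN s0 oppr0 => /(_ _ erefl j isT) H0.
  by apply/eqP; rewrite -oppr_eq0 H0 // => l _; rewrite oppr_ge0; case: (gle l).
have /zero_rmodP Q0 := gen_hom0_zero GQ NQ.
move=> x; apply/tE; apply/pE; exact: Q0.
Qed.

(** * Additive functions, composition series and dimension vectors *)

Lemma additive_zero theta Z : exact_additive theta -> zero_rmod Z -> theta Z = 0.
Proof.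
move=> ta /zero_rmodP Z0.
have := ta Z Z Z (hid Z) (hid Z); rewrite -{1}[theta Z]addr0 => H.
apply/esym/(addrI (theta Z)); apply: H => x; first by [].
  by exists x; rewrite homE.
by split=> _; [exists x; rewrite homE | exact: Z0].
Qed.

Lemma additive_iso theta X Y : exact_additive theta -> iso X Y -> theta X = theta Y.
Proof.
move=> ta [f [fI fS]]; have [Z Z0] := zero_exists A.
have z := (zero_rmodP Z).1 Z0.
rewrite -[RHS]add0r -(additive_zero ta Z0); apply: (ta _ _ _ (hzero Z X) f) => // x.
split=> [/fI->|[y <-]]; last by rewrite homE linear0.
by exists 0; rewrite linear0.
Qed.

Lemma additive_simples n (S : 'I_n -> rmod A) theta X (v : 'rV[nat]_n) :
  all_simples S -> exact_additive theta -> dimension_vector S X v ->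
  theta X = \sum_i theta (S i) * (v ord0 i)%:R.
Proof.
move=> [Ss Sn SE] ta [s sX vE].
under eq_bigr => i _ do rewrite vE.
elim: sX {vE} => [Y Y0|{}X Y Q {}s i p Qs iH pH iI ip pS _ IH].
  by rewrite (additive_zero ta Y0) big1 // => i _; rewrite mulr0.
have -> : theta X = theta Y + theta Q.
  apply: (ta X Y Q (RHom iH) (RHom pH)); [exact/inj_lker | exact/surj_limg |].
  move=> x; apply: iff_trans (mem_limg (RHom iH) x); rewrite /= ip memv_ker.
  exact: (rwP eqP).
rewrite IH addrC; have [j Qj] := SE Q Qs.
have -> : theta Q = \sum_l theta (S l) * (`[< rmod_iso Q (S l) >] : nat)%:R.
  rewrite (bigD1 j) //= big1 => [|l lj].
    by rewrite (asboolT Qj) mulr1 addr0; apply/additive_iso/isoP.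
  rewrite asboolF ?mulr0 // => Ql; move/eqP: lj; apply.
  by apply/esym/Sn/isoP; apply: iso_trans (iso_sym ((isoP _ _).2 Qj)) ((isoP _ _).2 Ql).
by rewrite -big_split; apply: eq_bigr => l _; rewrite /= natrD mulrDr.
Qed.

Lemma simple_quotient X : ~ zero_rmod X -> exists Q (p : rhom X Q), simple_rmod Q /\ surj p.
Proof.
move=> X0.
pose P n := `[< exists Q (p : rhom X Q), [/\ ~ zero_rmod Q, surj p & n = dimM Q] >].
have exP : exists n, P n.
  exists (dimM X); apply/asboolP; exists X, (hid X); split=> // x.
  by exists x; rewrite homE.
case: (ex_minnP exP) => _ /asboolP[Q [p [Q0 pS ->]]] Qmin.
exists Q, p; split=> //; split=> // W Ws.
have [Q' [p' [p'S p'E]]] := quotient_exists Ws.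
have [/zero_rmodP Z|Q'0] := pselect (zero_rmod Q').
  right; apply/eqP; rewrite eqEsubv subvf; apply/subvP => x _.
  by apply/p'E.
left; have p'I : inj p'.
  apply: (surj_inj p'S); apply: Qmin; apply/asboolP; exists Q', (hcomp p' p); split=> //.
  by move=> y; have [x <-] := p'S y; have [z <-] := pS x; exists z; rewrite homE.
apply/eqP; rewrite -subv0; apply/subvP => x /p'E/p'I ->.
by rewrite mem0v.
Qed.

Lemma composition_factors_exist X : exists s, composition_factors X s.
Proof.
have [n] := ubnP (dimM X); elim: n X => // n IH X /ltnSE Xn.
have [X0|X0] := pselect (zero_rmod X); first by exists [::]; exact: CompositionNil.
have [Q [p [Qs pS]]] := simple_quotient X0.
have [Y [i [iI iE]]] := ker_exists p.
have e : lker p = limg i.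
  by apply/vspaceP => x; apply/idP/idP; rewrite memv_ker; [move/eqP/iE/mem_limg | move/mem_limg/iE ->].
have [|s sY] := IH Y.
  rewrite (leq_trans _ Xn) // /dimM -(limg_ker_dim p fullv) capfv e.
  rewrite limg_dim_eq ?(inj_lker i).1 ?capv0 // -addn1 leq_add2l lt0n (surj_limg p).1 //.
  by apply/eqP => /zero_dim; case: Qs.
exists (Q :: s); apply: (CompositionCons Qs (homP i) (homP p)) sY => //.
- exact/inj_lker.
- exact/surj_limg.
Qed.

Lemma dimension_vector_exists n (S : 'I_n -> rmod A) X : exists v, dimension_vector S X v.
Proof.
have [s sX] := composition_factors_exist X.
exists (\row_i count (fun Q => `[< rmod_iso Q (S i) >]) s), s => // i.
by rewrite mxE.
Qed.

(** By additivity [theta] is a linear form [ell] on dimension vectors. The half-space [ell >= 0] is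
    convex and contains the points generating the polytope of U, hence the whole polytope, in which
    the dimension vectors of quotients of V lie. *)
Lemma newton_halfspace (R : realType) n (S : 'I_n -> rmod A) theta U V :
  all_simples S -> exact_additive theta ->
  newton_polytope R S U = newton_polytope R S V ->
  (forall Q, quotient_of U Q -> 0 <= theta Q) ->
  forall Q, quotient_of V Q -> 0 <= theta Q.
Proof.
move=> Ss ta NUV HU Q VQ.
pose ell (w : 'rV[R]_n) : R := \sum_i ratr (theta (S i)) * w ord0 i.
have ellE X v : dimension_vector S X v -> ell (map_mx (GRing.natmul 1) v) = ratr (theta X).
  move=> vX; rewrite (additive_simples Ss ta vX) rmorph_sum; apply: eq_bigr => i _ /=.
  by rewrite rmorphM /= mxE ratr_nat.
have sub : (newton_polytope R S U `<=` [set w | 0 <= ell w])%classic.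
  apply: smallest_sub.
    move=> x y t; rewrite !inE /= => x0 y0.
    have -> : ell (conv t x y) = t%:num * ell x + (1 - t%:num) * ell y.
      have -> : conv t x y = t%:num *: (x : 'rV[R]_n) + (1 - t%:num) *: (y : 'rV[R]_n) by [].
      rewrite /ell !mulr_sumr -big_split; apply: eq_bigr => i _ /=.
      by rewrite !mxE; ring.
    by rewrite addr_ge0 ?mulr_ge0 // subr_ge0.
  by move=> _ [Q' [v [UQ' vQ' ->]]] /=; rewrite (ellE _ _ vQ') ler0q; exact: HU.
have [v vQ] := dimension_vector_exists S Q.
rewrite -(ler0q R) -(ellE _ _ vQ); apply: sub; rewrite NUV.
by apply: sub_gen_smallest; exists Q, v.
Qed.

Lemma hom_brick_surj N U V (h : rhom V U) : brick U ->
  (forall B, Gen N B -> hom0 U B -> zero_rmod B) -> Gen N V ->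
  (exists x, h x <> 0) -> surj h.
Proof.
move=> [U0 Ub] NB GV [x hx]; have [I [p [j [pS jI hE]]]] := im_factor h.
have /not_hom0[k [y ky]] : ~ hom0 U I.
  move=> /(NB I (gen_surj pS GV))/zero_rmodP I0.
  by apply: hx; rewrite hE (I0 (p x)) linear0.
have [|g [_ _ /lfunP jkg]] := Ub (hcomp j k) (homP _).
  by move=> /lfunP/(_ y); rewrite hcompE zero_lfunE => /jI.
move=> z; have [t tE] := pS (k (g z)); exists t.
by have := jkg z; rewrite comp_lfunE id_lfunE hcompE hE tE.
Qed.

End Chain.

Theorem corollary1p7 (K : fieldType) (A : falgType K) (R : realType)
    (n : nat) (S : 'I_n -> rmod A) (S_simples : all_simples S)
    (A_basic : basic_algebra A) (A_finite : tau_tilting_finite A)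
    (U V : rmod A) (U_brick : brick U) (V_brick : brick V)
    (NUV : newton_polytope R S U = newton_polytope R S V) :
  rmod_iso U V.
Proof.
have transfer X Y : newton_polytope R S X = newton_polytope R S Y ->
    exists N, (forall B, Gen N B -> hom0 X B -> zero_rmod B) /\ Gen N Y.
  move=> NXY; have [N [Nr GX NB]] := minimal_rigid X A_finite.
  have [theta [ta thetaE]] := gen_stability Nr.
  exists N; split=> //; apply/thetaE.
  exact: newton_halfspace S_simples ta NXY ((thetaE X).1 GX).
have [N [NB GV]] := transfer U V NUV.
have [N' [NB' GU]] := transfer V U (esym NUV).
have /not_hom0[h [x hx]] : ~ hom0 V U by move=> /(NB' U GU); case: U_brick.
have /not_hom0[k [y ky]] : ~ hom0 U V by move=> /(NB V GV); case: V_brick.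
have hS : surj h by apply: hom_brick_surj U_brick NB GV _; exists x.
have kS : surj k by apply: hom_brick_surj V_brick NB' GU _; exists y.
apply/isoP; exists k; split=> //.
(* The surjection [h] supplies the dimension bound that makes [k] injective. *)
by apply: surj_inj kS _; exact: surj_dim hS.
Qed.
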